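(* Let $d\ge 1$ and let $\mathcal{P}\in\mathscr{P}_d$ be a pencil of plane curves of degree $d$. If all members of $\mathcal{P}$ are semistable plane curves, then $\mathcal{P}$ is semistable. If all members of $\mathcal{P}$ are stable plane curves, then $\mathcal{P}$ is stable.
   Context: The ground field is $\mathbb{C}$. Let $S_d$ be the vector space of homogeneous forms of degree $d$ in three variables. A plane curve of degree $d$ is $C_f=\{f=0\}\subset\mathbb{P}^2$ with $0\ne f\in S_d$ taken up to scalar, i.e. a point of $\mathbb{P}(S_d)$ (possibly non-reduced or reducible). A pencil of plane curves of degree $d$ is a two-dimensional subspace of $S_d$; its members are the $C_f$ with $f$ a nonzero element of that subspace. The space of all such pencils is $\mathscr{P}_d=Gr(2,S_d)$, embedded by Plücker coordinates in $\mathbb{P}(\Lambda^2 S_d)$. Stability: $SL(3)$ acts on $S_d$ by linear changes of coordinates, hence on $\mathbb{P}(S_d)$, on $\Lambda^2S_d$ and on $\mathscr{P}_d\subset\mathbb{P}(\Lambda^2S_d)$. A point of a projective variety $X\subset\mathbb{P}(W)$ with linear $SL(3)$-action is semistable if, for a nonzero lift $\tilde{x}\in W$, $0\notin\overline{SL(3)\cdot\tilde{x}}$; it is stable if the orbit $SL(3)\cdot\tilde{x}$ is closed in $W$ and the stabilizer of $\tilde{x}$ is finite. This is applied to curves ($X=\mathbb{P}(S_d)$) and to pencils ($X=\mathscr{P}_d$). *)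

(* Defs.v *)
From HB Require Import structures.
From mathcomp Require Import all_boot all_order all_algebra.
From mathcomp Require Import boolp classical_sets cardinality reals complex.
From mathcomp Require Import mpoly.

Set Implicit Arguments.
Unset Strict Implicit.
Unset Printing Implicit Defensive.

Import GRing.Theory.
Local Open Scope classical_set_scope.
Local Open Scope ring_scope.

(* All closures are taken for the Zariski topology of a finite-dimensional
   vector space W: regular functions on W are the polynomials in the
   coordinates with respect to the basis [vbasis fullv], and the closed sets
   do not depend on that basis. *)
Section Zariski.
Context {K : fieldType} {W : vectType K}.

Definition poly_fun (p : {mpoly K[\dim {:W}]}) (x : W) : K :=
  p.@[fun i => coord (vbasis {:W}) i x].

Definition zariski_closed (Z : set W) : Prop :=
  exists S : set {mpoly K[\dim {:W}]},
    Z = [set x | forall p, S p -> poly_fun p x = 0].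

Definition zariski_closure (A : set W) : set W := smallest zariski_closed A.

End Zariski.

(* Exterior square: a vector is given by its coordinates on the e_i /\ e_j,
   i < j, where (e_i) is the basis [vbasis fullv] of V. *)
Section ExteriorSquare.
Context {K : fieldType}.

Definition ext2_index (V : vectType K) : Type :=
  {p : 'I_(\dim {:V}) * 'I_(\dim {:V}) | (p.1 < p.2)%N}.
HB.instance Definition _ (V : vectType K) := Finite.on (ext2_index V).

Definition ext2 (V : vectType K) : Type := {ffun ext2_index V -> K^o}.
HB.instance Definition _ (V : vectType K) := Vector.on (ext2 V).

Definition wedge (V : vectType K) (u v : V) : ext2 V :=
  [ffun p => coord (vbasis {:V}) (val p).1 u * coord (vbasis {:V}) (val p).2 v
           - coord (vbasis {:V}) (val p).2 u * coord (vbasis {:V}) (val p).1 v].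

(* The linear map sending e_i /\ e_j to A e_i /\ A e_j. *)
Definition ext2_map (V V' : vectType K) (A : {linear V -> V'}) (w : ext2 V) :
  ext2 V' :=
  \sum_(p : ext2_index V)
     w p *: wedge (A (vbasis {:V})`_(val p).1) (A (vbasis {:V})`_(val p).2).

Lemma ext2_map_wedge (V V' : vectType K) (A : {linear V -> V'}) (u v : V) :
  ext2_map A (wedge u v) = wedge (A u) (A v).
Proof.
have ext_ord (n : nat) (F : 'I_n -> 'I_n -> K) :
    (forall i j, F i j = - F j i) -> (forall i, F i i = 0) ->
    forall c : 'I_n -> 'I_n -> K,
    \sum_i \sum_j c i j * F i j =
    \sum_(p : {p : 'I_n * 'I_n | (p.1 < p.2)%N})
      (c (val p).1 (val p).2 - c (val p).2 (val p).1) * F (val p).1 (val p).2.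
  move=> Fa F0 c.
  rewrite pair_big /= (bigID (fun p : 'I_n * 'I_n => (p.1 < p.2)%N)) /=.
  rewrite [X in _ + X](bigID (fun p : 'I_n * 'I_n => (p.2 < p.1)%N)) /=.
  rewrite [X in _ + (_ + X)]big1 => [|[i j] /=]; last first.
    rewrite -!leqNgt andbC => /andP[ji ij].
    have -> : i = j by apply/val_inj/eqP; rewrite eqn_leq ij ji.
    by rewrite F0 mulr0.
  rewrite addr0 [X in _ + X](eq_bigl (fun p : 'I_n * 'I_n => (p.2 < p.1)%N)); last first.
    by move=> [i j] /=; rewrite andb_idl // -leqNgt; exact: ltnW.
  rewrite [X in _ + X](reindex_inj (h := fun p => (p.2, p.1))) /=; last first.
    by move=> [i j] [k l] [-> ->].
  rewrite -big_split /=.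
  rewrite (eq_bigr (fun p : 'I_n * 'I_n =>
     (c p.1 p.2 - c p.2 p.1) * F p.1 p.2)); last first.
    by move=> [i j] _ /=; rewrite (Fa j i) mulrN -mulrBl.
  rewrite (reindex_omap (val : {p : 'I_n * 'I_n | (p.1 < p.2)%N} -> _) insub).
    by apply: eq_bigl => p; rewrite (valP p) valK eqxx.
  by move=> p pP /=; rewrite insubT.
apply/ffunP => q; rewrite sum_ffunE !ffunE.
set e := vbasis {:V}; set e' := vbasis {:V'}.
have coordA (k : 'I_(\dim {:V'})) x :
    coord e' k (A x) = \sum_i coord e i x * coord e' k (A e`_i).
  rewrite {1}(coord_vbasis (memvf x)) !linear_sum /=.
  by apply: eq_bigr => i _; rewrite !linearZ.
pose F (i j : 'I_(\dim {:V})) := wedge (A e`_i) (A e`_j) q : K.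
have Fa i j : F i j = - F j i by rewrite /F !ffunE opprB [X in _ = X - _]mulrC
  [X in _ = _ - X]mulrC.
have F0 i : F i i = 0 by rewrite /F !ffunE mulrC subrr.
transitivity (\sum_i \sum_j (coord e i u * coord e j v) * F i j).
  by rewrite (ext_ord _ F Fa F0); apply: eq_bigr => p _; rewrite /F !ffunE.
rewrite !(coordA _ u) !(coordA _ v) !big_distrlr /= -sumrB.
apply: eq_bigr => i _; rewrite -sumrB; apply: eq_bigr => j _.
by rewrite /F !ffunE mulrBr; congr (_ - _); rewrite mulrACA.
Qed.

End ExteriorSquare.

Section Forms.
Context (K : fieldType) (d : nat).

Definition ternary_form : vectType K := dhomog 3 K d.

Definition lin_subst (g : 'M[K]_3) : 3.-tuple {mpoly K[3]} :=
  [tuple \sum_(j < 3) invmx g i j *: 'X_j | i < 3].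

Lemma form_act_subproof (g : 'M[K]_3) (f : ternary_form) :
  (mpoly_of_dhomog f \mPo lin_subst g) \is d.-homog.
Proof.
rewrite comp_mpolyEX big_seq; apply: rpred_sum => m mf; apply: rpredZ.
have <- : mdeg m = d by apply: (elimT (dhomogP mdeg d f)) mf; exact: dhomog_is_dhomog.
rewrite comp_mpolyX mdegE.
apply: (big_ind2 (fun (p : {mpoly K[3]}) n => p \is n.-homog)).
- exact: dhomog1.
- by move=> p k q l hp hq; apply: dhomogM.
move=> i _; rewrite -[X in X.-homog]mul1n; apply: dhomogMn.
rewrite tnth_mktuple; apply: rpred_sum => j _; apply: rpredZ.
by rewrite dhomogX /= mdeg1.
Qed.

(* (g . f)(x) = f (g^-1 x), a left action of the invertible matrices. *)
Definition form_act (g : 'M[K]_3) (f : ternary_form) : ternary_form :=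
  DHomog (form_act_subproof g f).

Lemma form_act_is_linear (g : 'M[K]_3) : linear (form_act g).
Proof.
by move=> c p q; apply: val_inj; rewrite /= comp_mpolyD comp_mpolyZ.
Qed.
HB.instance Definition _ (g : 'M[K]_3) :=
  GRing.isLinear.Build K ternary_form ternary_form _ (form_act g)
    (form_act_is_linear g).

Definition ext2_act (g : 'M[K]_3) (w : ext2 ternary_form) : ext2 ternary_form :=
  ext2_map (form_act g) w.

End Forms.

Section Stability.
Context {K : fieldType} {W : vectType K}.
Variable act : 'M[K]_3 -> W -> W.

Definition SL3 : set 'M[K]_3 := [set g | \det g = 1].

Definition SL3_orbit (x : W) : set W := [set act g x | g in SL3].

Definition SL3_stabilizer (x : W) : set 'M[K]_3 :=
  [set g | SL3 g /\ act g x = x].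

Definition semistable_vec (x : W) : Prop := ~ zariski_closure (SL3_orbit x) 0.

Definition stable_vec (x : W) : Prop :=
  zariski_closed (SL3_orbit x) /\ finite_set (SL3_stabilizer x).

End Stability.

Section Curves.
Context {K : fieldType} {d : nat}.

Definition semistable_curve (f : ternary_form K d) : Prop :=
  semistable_vec (@form_act K d) f.
Definition stable_curve (f : ternary_form K d) : Prop :=
  stable_vec (@form_act K d) f.

(* When (f, g) runs over the bases of the plane P, f /\ g runs over all the
   nonzero lifts of the Pluecker point of P. *)
Definition semistable_pencil (P : {vspace ternary_form K d}) : Prop :=
  forall f g : ternary_form K d, basis_of P [:: f; g] ->
    semistable_vec (@ext2_act K d) (wedge f g).
Definition stable_pencil (P : {vspace ternary_form K d}) : Prop :=
  forall f g : ternary_form K d, basis_of P [:: f; g] ->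
    stable_vec (@ext2_act K d) (wedge f g).

End Curves.

(* Main.v *)
Require Import Defs.
From HB Require Import structures.
From mathcomp Require Import all_boot all_order all_algebra fingroup perm.
From mathcomp Require Import boolp classical_sets functions cardinality reals complex.
From mathcomp Require Import mpoly ring.

Set Implicit Arguments.
Unset Strict Implicit.
Unset Printing Implicit Defensive.

Import GRing.Theory Num.Theory.
Local Open Scope classical_set_scope.
Local Open Scope ring_scope.

(** The classical argument runs through the Hilbert-Mumford criterion: an
    unstable pencil [f /\ f'] is destabilized by a one-parameter subgroup, for
    which the weight of [f /\ f'] is the sum of the weights of the members of
    a basis adapted to the weight filtration, so that one of these members is
    destabilized too.  The proof below keeps this idea but replaces
    one-parameter subgroups and curves by a place, that is, by a valuation
    ring with residue field [K] whose value group is an arbitrary ordered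
    abelian group.  No passage from the Zariski topology to curves is then
    needed.

    Places.  Let [T] be a set of parameters.  A maximal place is a maximal
    subring [G] of [(T -> K) * K] that contains the constants [(c, c)] and no
    [(0, c)] with [c != 0]; [(x, c)] in [G] is read: the family [x] has limit
    [c].  Since [K] is algebraically closed, every family either has a limit or
    has a pointwise inverse of limit [0]
    ([maximal_place_dichotomy]).  If [z] lies in the Zariski closure of a
    family of points, then some place makes that family tend to [z]
    ([adherent_place]): the polynomials in the family give a partial place,
    which Zorn's lemma enlarges.

    Cartan decomposition.  A family [g] in SL(3) is equal, almost everywhere
    for the place, to [k1 * diag a * k2] with [k1], [k2] in SL(3) with finite
    limits ([cartan_sl]); this is elimination with pivots of minimal
    valuation.

    Members.  Suppose that [g f /\ g f'] is finite, or tends to [0].  Some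
    combination [alpha f + beta f'] with finite coefficients, not both of
    limit [0], has all coordinates of [g (alpha f + beta f')] finite, or
    tending to [0] ([primitive_combination]).  Cancelling [k1] and passing to
    the limit in [k2], one gets a nonzero member [f1] of the pencil and
    [kappa] in SL(3) such that each monomial of [kappa f1] has a weight
    under [diag a] that is finite, or tends to [0] ([pencil_destabilized]).

    Conclusion.  If the weights tend to [0], then so does [diag a * kappa f1],
    and [f1] is not semistable.  If the weights are finite and [diag a] is
    not, then [diag a * kappa f1] tends to a form [f0] whose monomials all
    have weights that are units.  The exponents of these monomials lie in a
    plane through [(1, 1, 1)], so that an infinite torus in SL(3) fixes [f0]
    ([fixing_weights]); but if [f1] were
    stable, [f0] would be in its orbit and would have a finite stabilizer.
    Hence, for a pencil with stable members, [g] is finite as soon as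
    [g f /\ g f'] is ([finite_of_finite_wedge]: the orbit map is proper).
    So the orbit is closed, since a limit of [g f /\ g f'] is
    [gamma f /\ gamma f'] with [gamma] the limit of [g], and the stabilizer
    is finite, since an infinite one would contain a family with an entry
    going to infinity ([unbounded_place]). *)

(** * Matrices of determinant one *)

Section Matrices.
Context {K : fieldType}.

Lemma tperm_mxK n (i j : 'I_n) : tperm_mx i j *m tperm_mx i j = 1%:M :> 'M[K]_n.
Proof. by rewrite -perm_mxM tperm2 perm_mx1. Qed.

Lemma invmxM n (g1 g2 : 'M[K]_n) : g1 \in unitmx -> g2 \in unitmx ->
  invmx (g1 *m g2) = invmx g2 *m invmx g1.
Proof.
move=> u1 u2; have u12 : g1 *m g2 \in unitmx by rewrite unitmx_mul u1.
apply: (can_inj (mulKmx u12)); rewrite mulmxV // mulmxA -(mulmxA g1) mulmxV //.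
by rewrite mulmx1 mulmxV.
Qed.

Lemma unitmx_sl n (g : 'M[K]_n) : \det g = 1 -> g \in unitmx.
Proof. by move=> g1; rewrite unitmxE g1 unitr1. Qed.

Lemma invmx_sl n (g : 'M[K]_n) : \det g = 1 -> invmx g = \adj g.
Proof. by move=> g1; rewrite /invmx unitmx_sl // g1 invr1 scale1r. Qed.

Lemma sl_diag_neq0 n (a : 'rV[K]_n) : \prod_i a 0 i = 1 -> forall i, a 0 i != 0.
Proof.
move=> a1 i; apply/eqP => ai0; move/eqP: a1.
by rewrite (bigD1 i) //= ai0 mul0r eq_sym oner_eq0.
Qed.

End Matrices.

(** * Places on rings of functions *)

Section PartialPlaces.
Context {T : pointedType} {K : closedFieldType}.
Implicit Types (G : set ((T -> K) * K)) (x y : T -> K).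

Record partial_place G : Prop := PartialPlace {
  pplace_cst : forall c, G (cst c, c);
  pplaceB : forall u v, G u -> G v -> G (u - v);
  pplaceM : forall u v, G u -> G v -> G (u * v);
  pplace_fun : forall c, G (0, c) -> c = 0 }.

(** An inverse in the sense of von Neumann regular rings: [x * pinv x] is the
    indicator function of the set where [x] is nonzero. *)
Definition pinv x : T -> K := fun t => (x t)^-1.

Lemma pinvK : involutive pinv.
Proof. by move=> x; apply/funext => t; rewrite /pinv invrK. Qed.

Lemma mulrpinv x : x * (pinv x * x) = x.
Proof.
apply/funext => t; rewrite /pinv /GRing.mul /=.
have [->|xt0] := eqVneq (x t) 0; first by rewrite mul0r.
by rewrite mulVf ?mulr1.
Qed.

Definition pplace_poly G (q : {poly (T -> K) * K}) : Prop := forall i, G q`_i.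

Section Closure.
Context {G} (hG : partial_place G).

Lemma pplace0 : G 0. Proof. exact: (pplace_cst hG 0). Qed.
Lemma pplace1 : G 1. Proof. exact: (pplace_cst hG 1). Qed.
Lemma pplaceN u : G u -> G (- u).
Proof. by move=> Gu; rewrite -[- u]sub0r; apply: pplaceB => //; exact: pplace0. Qed.
Lemma pplaceD u v : G u -> G v -> G (u + v).
Proof. by move=> Gu Gv; rewrite -[v]opprK; apply: pplaceB => //; exact: pplaceN. Qed.
Lemma pplaceX u n : G u -> G (u ^+ n).
Proof.
move=> Gu; elim: n => [|n IH]; first by rewrite expr0; exact: pplace1.
by rewrite exprS; apply: pplaceM.
Qed.
Lemma pplace_sum I (r : seq I) (P : pred I) (F : I -> ((T -> K) * K)%type) :
  (forall i, P i -> G (F i)) -> G (\sum_(i <- r | P i) F i).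
Proof.
by move=> GF; apply: big_ind GF; [exact: pplace0|exact: pplaceD].
Qed.
Lemma pplace_polyC u : G u -> pplace_poly G u%:P.
Proof. by move=> Gu i; rewrite coefC; case: eqP => // _; exact: pplace0. Qed.
Lemma pplace_polyX : pplace_poly G 'X.
Proof. by move=> i; rewrite coefX; case: eqP => _; [exact: pplace1|exact: pplace0]. Qed.
Lemma pplace_polyB p q : pplace_poly G p -> pplace_poly G q -> pplace_poly G (p - q).
Proof. by move=> Gp Gq i; rewrite coefB; exact: pplaceB. Qed.
Lemma pplace_polyM p q : pplace_poly G p -> pplace_poly G q -> pplace_poly G (p * q).
Proof. by move=> Gp Gq i; rewrite coefM; apply: pplace_sum => j _; exact: pplaceM. Qed.

End Closure.

(** The obstructions to giving [x] a limit [c]: [c] has to be a common root of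
    the polynomials obtained by taking limits of the coefficients in the
    polynomial relations satisfied by [x]. *)
Definition residual_relations G x : set {poly K} :=
  [set r | exists q, [/\ pplace_poly G q, (map_poly fst q).[x] = 0
                       & map_poly snd q = r]].

Lemma map_lift_poly (r : {poly K}) G : partial_place G ->
  exists q, pplace_poly G q /\ map_poly snd q = r.
Proof.
move=> hG; exists (\poly_(i < size r) (cst r`_i, r`_i)); split.
  by move=> i; rewrite coef_poly; case: ifP => _; [exact: pplace_cst|exact: pplace0].
by apply/polyP => i; rewrite coef_map /= coef_poly; case: ltnP => // /(nth_default 0) ->.
Qed.

(** The Nullstellensatz in one variable: take an element of least degree. *)
Lemma ideal_root_or_unit (I : set {poly K}) :
  I 0 -> (forall p q, I p -> I q -> I (p - q)) -> (forall p q, I q -> I (p * q)) ->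
  I 1 \/ exists c, forall p, I p -> root p c.
Proof.
move=> I0 IB IM.
case: (pselect (exists p, I p /\ p != 0)) => [[p0 [Ip0 p00]]|none]; last first.
  right; exists 0 => p Ip; case: (eqVneq p 0) => [->|p_neq0]; first exact: root0.
  by case: none; exists p.
have exn : exists n, `[< exists p, [/\ I p, p != 0 & size p = n] >].
  by exists (size p0); apply/asboolP; exists p0.
case: (ex_minnP exn) => n /asboolP[p [Ip pn0 sp]] hmin.
have dvd q : I q -> p %| q.
  move=> Iq; apply/modp_eq0P/eqP; apply: contraT => r_neq0.
  have H : `[< exists r, [/\ I r, r != 0 & size r = size (q %% p)] >].
    apply/asboolP; exists (q %% p); split => //.
    have -> : q %% p = q - (q %/ p) * p by apply/eqP; rewrite eq_sym subr_eq addrC -divp_eq.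
    by apply: IB => //; apply: IM.
  by have := hmin _ H; rewrite -sp leqNgt ltn_modp pn0.
have [/eqP sp1|/closed_rootP[c pc]] := boolP (size p == 1).
  left; rewrite [1](_ : _ = (lead_coef p)^-1%:P * p); first exact: IM.
  have /size_poly1P[c c0 ->] : size p == 1 by apply/eqP.
  by rewrite lead_coefC -polyCM mulVf.
by right; exists c => q /dvd/dvdpP[r ->]; rewrite rootM pc orbT.
Qed.

Lemma residual_root_or_unit G x : partial_place G ->
  residual_relations G x 1 \/ exists c, forall p, residual_relations G x p -> root p c.
Proof.
move=> hG; apply: ideal_root_or_unit.
- exists 0; split; rewrite ?map_poly0 ?horner0 //; first by move=> i; rewrite coef0; exact: pplace0.
- move=> _ _ [p [Gp p0 <-]] [q [Gq q0 <-]]; exists (p - q); split.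
  + exact: pplace_polyB.
  + by rewrite rmorphB /= hornerD hornerN p0 q0 subr0.
  + by rewrite rmorphB.
move=> r _ [q [Gq q0 <-]]; have [p [Gp <-]] := map_lift_poly r hG.
exists (p * q); split.
- exact: pplace_polyM.
- by rewrite rmorphM /= hornerM q0 mulr0.
- by rewrite rmorphM.
Qed.


Definition maximal_place G := partial_place G /\
  forall G', partial_place G' -> G `<=` G' -> G' `<=` G.

(** Zorn's lemma, applied to the sets [X] such that [X `|` G0] is a partial
    place rather than to the partial places that contain [G0]: the empty chain
    then needs no separate treatment. *)
Lemma exists_maximal_place G0 : partial_place G0 ->
  exists G, maximal_place G /\ G0 `<=` G.
Proof.
move=> h0.
pose P : set (set ((T -> K) * K)%type) := [set X | partial_place (X `|` G0)].
have [F FP totF|A [PA maxA]] := @Zorn_bigcup _ P.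
  have cup2 u v : (\bigcup_(X in F) X `|` G0) u -> (\bigcup_(X in F) X `|` G0) v ->
      exists2 X, partial_place (X `|` G0) /\ X `<=` \bigcup_(X in F) X &
        (X `|` G0) u /\ (X `|` G0) v.
    case=> [[X FX Xu]|Gu] [[Y FY Yv]|Gv].
    - have [XY|YX] := totF _ _ FX FY.
        by exists Y; [split; [exact: FP|exact: bigcup_sup]|split; left => //; exact: XY].
      by exists X; [split; [exact: FP|exact: bigcup_sup]|split; left => //; exact: YX].
    - by exists X; [split; [exact: FP|exact: bigcup_sup]|split; [left|right]].
    - by exists Y; [split; [exact: FP|exact: bigcup_sup]|split; [right|left]].
    - by exists set0; [split; [rewrite set0U|]|split; right].
  rewrite /P /=; constructor.
  - by move=> c; right; exact: pplace_cst.
  - move=> u v Fu Fv; have [X [hX XF] [Xu Xv]] := cup2 u v Fu Fv.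
    by have [/XF|] := pplaceB hX Xu Xv; [left|right].
  - move=> u v Fu Fv; have [X [hX XF] [Xu Xv]] := cup2 u v Fu Fv.
    by have [/XF|] := pplaceM hX Xu Xv; [left|right].
  - move=> c Fc; have [X [hX _] [Xc _]] := cup2 _ _ Fc Fc.
    exact: pplace_fun hX _ Xc.
exists (A `|` G0); split; last exact: subsetUr.
split=> // G' hG' AG'.
have PG' : P G'.
  rewrite /P /= (_ : G' `|` G0 = G') //.
  by apply/setUidPl; apply: subset_trans AG'; exact: subsetUr.
suff : G' `<=` A by move=> GA; apply: (subset_trans GA); exact: subsetUl.
apply: contrapT => nGA; apply: (maxA G') PG'; split=> //.
by apply: subset_trans AG'; exact: subsetUl.
Qed.

Section Maximal.
Context {G} (hG : maximal_place G).
Let pG : partial_place G := hG.1.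

(** The elements that land in [G] after multiplication by a power of [(x, c)]
    form a partial place, which is [G] by maximality. *)
Lemma maximal_place_pinv x c : G (x, c) -> c != 0 -> G (pinv x, c^-1).
Proof.
move=> Gxc c0.
pose G' : set ((T -> K) * K)%type := [set u | exists n, G (u * (x, c) ^+ n)].
have up u m n : (m <= n)%N -> G (u * (x, c) ^+ m) -> G (u * (x, c) ^+ n).
  move=> mn Gu; rewrite -(subnKC mn) exprD mulrA.
  by apply: pplaceM => //; exact: pplaceX.
suff hG' : partial_place G'.
  apply: (hG.2 G' hG').
    by move=> u Gu; exists 0%N; rewrite expr0 mulr1.
  exists 2; rewrite expr2.
  have -> : (pinv x, c^-1) * ((x, c) * (x, c)) = (x, c) :> ((T -> K) * K)%type.
    congr pair => /=; last by rewrite mulKf.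
    by rewrite mulrA mulrC mulrpinv.
  by [].
constructor.
- by move=> a; exists 0%N; rewrite expr0 mulr1; exact: pplace_cst.
- move=> u v [m Gu] [n Gv]; exists (maxn m n); rewrite mulrBl; apply: pplaceB => //.
    by apply: up Gu; exact: leq_maxl.
  by apply: up Gv; exact: leq_maxr.
- by move=> u v [m Gu] [n Gv]; exists (m + n)%N; rewrite exprD mulrACA; exact: pplaceM.
- move=> a [n].
  have -> : (0, a) * (x, c) ^+ n = (0, a * c ^+ n) :> ((T -> K) * K)%type.
    elim: n => [|n IH]; first by rewrite !expr0 !mulr1.
    by rewrite !exprSr !mulrA IH; congr pair => /=; rewrite mul0r.
  move/(pplace_fun pG)/eqP; rewrite mulf_eq0 expf_eq0 (negbTE c0) andbF orbF.
  by move/eqP.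
Qed.

(** The polynomials in [(x, c)] with coefficients in [G] form a partial place. *)
Lemma maximal_place_adjoin x c :
  (forall p, residual_relations G x p -> root p c) -> G (x, c).
Proof.
move=> xc.
pose G' : set ((T -> K) * K)%type := [set u | exists q, pplace_poly G q /\ q.[(x, c)] = u].
suff hG' : partial_place G'.
  apply: (hG.2 G' hG').
    by move=> u Gu; exists u%:P; split; [exact: pplace_polyC|rewrite hornerC].
  by exists 'X; split; [exact: pplace_polyX|rewrite hornerX].
constructor.
- move=> a; exists (cst a, a)%:P; rewrite hornerC; split=> //.
  by apply: pplace_polyC => //; exact: pplace_cst.
- by move=> _ _ [p [Gp <-]] [q [Gq <-]]; exists (p - q); split;
    [exact: pplace_polyB|rewrite hornerD hornerN].
- by move=> _ _ [p [Gp <-]] [q [Gq <-]]; exists (p * q); split;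
    [exact: pplace_polyM|rewrite hornerM].
move=> a [q [Gq qa]].
have := congr1 fst qa; have := congr1 snd qa; rewrite -!horner_map /= => <- q0.
by apply/rootP/xc; exists q.
Qed.

(** Were neither [x] nor its inverse finite, both would satisfy relations
    [1 + m_0 + m_1 x + ... = 0] with all [m_i] of limit [0].  As for valuation
    rings, the relation of smaller degree for the inverse, multiplied by a
    power of [x], lowers the degree of the other one. *)
Lemma no_two_relations x (p q : {poly (T -> K) * K}) :
  pplace_poly G p -> pplace_poly G q ->
  map_poly snd p = 1 -> map_poly snd q = 1 ->
  (map_poly fst p).[x] = 0 -> (map_poly fst q).[pinv x] = 0 -> False.
Proof.
have [n] := ubnP (size p + size q); elim: n => // n IH in x p q *.
wlog lqp : x p q / (size q <= size p)%N => [hwlog|].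
  have [lqp|/ltnW lpq] := leqP (size q) (size p); first exact: hwlog.
  move=> sn Gp Gq p1 q1 px qx; apply: (hwlog (pinv x) q p) => //.
    by rewrite addnC.
  by rewrite pinvK.
move=> sn Gp Gq p1 q1 px qx.
have snd_coef i : (p`_i).2 = (i == 0%N)%:R.
  by rewrite -coef1 -p1 coef_map.
have p_neq0 : size p != 0%N.
  rewrite size_poly_eq0; apply/eqP => p0; move: p1; rewrite p0 map_poly0 => /eqP.
  by rewrite eq_sym oner_eq0.
pose N := (size p).-1.
have sN : size p = N.+1 by rewrite prednK // lt0n.
have fst_horner (r : {poly (T -> K) * K}) :
    (map_poly fst r).[x] = \sum_(i < size r) (r`_i).1 * x ^+ i.
  rewrite (@horner_coef_wide _ (size r)) ?size_poly //.
  by apply: eq_bigr => i _; rewrite coef_map.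
have N_gt0 : (0 < N)%N.
  rewrite lt0n; apply/eqP => N0; suff /eqP : 1 = 0 :> K by rewrite oner_eq0.
  apply: (pplace_fun pG); move: px; rewrite fst_horner sN N0 big_ord1 expr0 mulr1 => <-.
  have -> : 1 = (p`_0).2 by rewrite snd_coef.
  by case: (p`_0) (Gp 0%N).
(* The relation [p] forces [x] to be nonzero wherever its constant term is,
   that is on the support of [e]; [e] itself has limit [1]. *)
pose e : T -> K := pinv (p`_0).1 * (p`_0).1.
have Ge : G (e, 1).
  have Gp0 : G ((p`_0).1, 1).
    have -> : 1 = (p`_0).2 by rewrite snd_coef.
    by case: (p`_0) (Gp 0%N).
  have := pplaceM pG (maximal_place_pinv Gp0 (oner_neq0 _)) Gp0.
  by congr G; congr pair => /=; rewrite invr1 mulr1.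
have exx : e * (x * pinv x) = e.
  apply/funext => t; rewrite /e /GRing.mul /= /pinv.
  have [xt0|xt0] := eqVneq (x t) 0; last by rewrite mulfV // mulr1.
  suff -> : (p`_0).1 t = 0 by rewrite mulr0 mul0r.
  have := congr1 (fun f => f t) px; rewrite /= fst_horner sN fct_sumE big_ord_recl /=.
  rewrite big1 ?addr0 => [|i _]; first by rewrite expr0 mulr1.
  by rewrite exprS /GRing.mul /= xt0 mul0r mulr0.
(* [Q] is [q] multiplied by [x ^ N]; the multiples of [p] and [Q] in [p'] are
   chosen so that the terms of degree [N] cancel. *)
pose Q := \poly_(j < N.+1) q`_(N - j).
pose u := p`_N.
pose p' := ((e, 1) * q`_0)%:P * p - (u * (e, 1))%:P * Q.
have map_snd_u : u.2 = 0 by rewrite snd_coef eqn0Ngt N_gt0.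
have GE : G (e, 1) by [].
have coefQ j : Q`_j = if (j < N.+1)%N then q`_(N - j) else 0 by rewrite coef_poly.
apply: (IH x p' q) => //.
- rewrite ltnS in sn; apply: leq_trans sn; rewrite -addSn leq_add2r sN ltnS.
  apply/leq_sizeP => j Nj; rewrite coefB !coefCM coefQ ltnS leqNgt.
  have [Nltj|] := ltnP N j.
    by rewrite mulr0 [p`_j]nth_default ?sN // mulr0 subr0.
  move=> jN; have -> : j = N by apply/eqP; rewrite eqn_leq jN.
  by rewrite subnn /= mulrAC [u * _]mulrC mulrAC subrr.
- have Gu : G (u * (e, 1)) by apply: pplaceM => //; exact: Gp.
  have GQ : pplace_poly G Q.
    by move=> j; rewrite coefQ; case: ifP => _; [exact: Gq|exact: pplace0].
  apply: (pplace_polyB pG); apply: (pplace_polyM pG) => //; apply: (pplace_polyC pG) => //.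
  by apply: pplaceM.
- have q01 : (q`_0).2 = 1.
    by rewrite -(coef_map snd) q1 coef1.
  rewrite rmorphB !rmorphM /= !map_polyC /= p1 map_snd_u q01.
  by rewrite !mulr1 polyC0 mul0r subr0 polyC1.
have fQ : (map_poly fst Q).[x] = \sum_(j < N.+1) (q`_j).1 * x ^+ (N - j).
  have -> : map_poly fst Q = \poly_(j < N.+1) (q`_(N - j)).1.
    by apply/polyP => j; rewrite coef_map /= coefQ coef_poly; case: ifP.
  rewrite horner_poly (reindex_inj rev_ord_inj) /=.
  by apply: eq_bigr => j _; rewrite subSS subKn // -ltnS.
rewrite rmorphB !rmorphM /= !map_polyC /= hornerD hornerN !hornerM !hornerC px mulr0 sub0r fQ.
suff -> : u.1 * e * (\sum_(j < N.+1) (q`_j).1 * x ^+ (N - j)) =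
   u.1 * (e * x ^+ N) * (map_poly fst q).[pinv x] by rewrite qx mulr0 oppr0.
rewrite (@horner_coef_wide _ N.+1); last first.
  by apply: (leq_trans (size_poly _ _)); rewrite -sN.
rewrite -!mulrA; congr (_ * _); rewrite !mulr_sumr; apply: eq_bigr => j _.
rewrite coef_map /=.
have exn (i : nat) : e = e * (x * pinv x) ^+ i.
  by elim: i => [|k IHk]; rewrite ?expr0 ?mulr1 // exprS mulrA exx.
have key M (i : nat) : (i <= M)%N -> e * x ^+ (M - i) = e * x ^+ M * pinv x ^+ i.
  by move=> /subnK <-; rewrite addnK {1}(exn i) exprD exprMn; ring.
transitivity ((q`_j).1 * (e * x ^+ (N - j))); first by rewrite /e; ring.
by rewrite key -1?ltnS // /e; ring.
Qed.

(** The defining property of a valuation ring with residue field [K]. *)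
Lemma maximal_place_dichotomy x : (exists c, G (x, c)) \/ G (pinv x, 0).
Proof.
case: (residual_root_or_unit x pG) => [[p [Gp px p1]]|[c xc]]; last first.
  by left; exists c; exact: maximal_place_adjoin.
case: (residual_root_or_unit (pinv x) pG) => [[q [Gq qx q1]]|[c xc]].
  by case: (no_two_relations Gp Gq p1 q1 px qx).
have /= Gxc := maximal_place_adjoin xc.
have [c0|c0] := eqVneq c 0; first by right; rewrite -c0.
by left; exists c^-1; rewrite -(pinvK x); exact: maximal_place_pinv.
Qed.

End Maximal.

End PartialPlaces.

(** * Limits along a place *)

Section Limits.
Context {T : pointedType} {K : closedFieldType}.
Variable G : set ((T -> K) * K)%type.
Implicit Types (x y : T -> K) (c : K) (D : set T).

Definition lim x c : Prop := G (x, c).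
Definition finite_at x : Prop := exists c, lim x c.
Definition indic D : T -> K := fun t => `[< D t >]%:R.
(** The sets in the ultrafilter on [T] attached to the place. *)
Definition almost_all D : Prop := lim (indic D) 1.

Context (hG : maximal_place G).
Let pG : partial_place G := hG.1.

Lemma lim_cst c : lim (fun=> c) c. Proof. exact: (pplace_cst pG). Qed.
Lemma limB x y c c' : lim x c -> lim y c' -> lim (fun t => x t - y t) (c - c').
Proof. exact: (pplaceB pG). Qed.
Lemma limM x y c c' : lim x c -> lim y c' -> lim (fun t => x t * y t) (c * c').
Proof. exact: (pplaceM pG). Qed.
Lemma limD x y c c' : lim x c -> lim y c' -> lim (fun t => x t + y t) (c + c').
Proof. exact: (pplaceD pG). Qed.
Lemma limN x c : lim x c -> lim (fun t => - x t) (- c).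
Proof. exact: (pplaceN pG). Qed.
Lemma lim_sum I (r : seq I) (P : pred I) (x : I -> T -> K) (c : I -> K) :
  (forall i, P i -> lim (x i) (c i)) ->
  lim (fun t => \sum_(i <- r | P i) x i t) (\sum_(i <- r | P i) c i).
Proof.
move=> xc; elim: r => [|i r IH].
  by under eq_fun do rewrite big_nil; rewrite big_nil; exact: lim_cst.
under eq_fun do rewrite big_cons; rewrite big_cons.
by case: ifP => // Pi; apply: limD => //; exact: xc.
Qed.
Lemma lim_prod I (r : seq I) (P : pred I) (x : I -> T -> K) (c : I -> K) :
  (forall i, P i -> lim (x i) (c i)) ->
  lim (fun t => \prod_(i <- r | P i) x i t) (\prod_(i <- r | P i) c i).
Proof.
move=> xc; elim: r => [|i r IH].
  by under eq_fun do rewrite big_nil; rewrite big_nil; exact: lim_cst.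
under eq_fun do rewrite big_cons; rewrite big_cons.
by case: ifP => // Pi; apply: limM => //; exact: xc.
Qed.
Lemma limX x c n : lim x c -> lim (fun t => x t ^+ n) (c ^+ n).
Proof.
move=> xc; elim: n => [|n IH]; first by under eq_fun do rewrite expr0; exact: lim_cst.
by under eq_fun do rewrite exprS; rewrite exprS; exact: limM.
Qed.

Lemma lim_unique x c c' : lim x c -> lim x c' -> c = c'.
Proof.
move=> xc xc'; apply/eqP; rewrite -subr_eq0; apply/eqP/(pplace_fun pG).
have := limB xc xc'; rewrite /lim; congr (G (_, _)).
by apply/funext => t; rewrite subrr.
Qed.

Lemma limV x c : lim x c -> c != 0 -> lim (fun t => (x t)^-1) c^-1.
Proof. exact: maximal_place_pinv. Qed.

Lemma finite_or_inv0 x : finite_at x \/ lim (fun t => (x t)^-1) 0.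
Proof. exact: maximal_place_dichotomy. Qed.

Lemma eq_lim x y c : x =1 y -> lim x c -> lim y c.
Proof. by move=> /funext ->. Qed.

Lemma almost_all_setT : almost_all setT.
Proof. by apply: (eq_lim _ (lim_cst 1)) => t; rewrite /indic asboolT. Qed.

Lemma almost_allI D D' : almost_all D -> almost_all D' -> almost_all (D `&` D').
Proof.
move=> hD hD'; have := limM hD hD'; rewrite mulr1; apply: eq_lim => t.
by rewrite /indic -natrM mulnb asbool_and.
Qed.

(** An idempotent is its own inverse, hence finite, and its limit is an
    idempotent of [K]. *)
Lemma indic_lim D : lim (indic D) 0 \/ almost_all D.
Proof.
have [c Dc] : finite_at (indic D).
  case: (finite_or_inv0 (indic D)) => // D0; exists 0; apply: eq_lim D0 => t.
  by rewrite /indic; case: `[< D t >]; rewrite ?invr1 ?invr0.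
have : c * c = c.
  apply: (lim_unique _ Dc); apply: eq_lim (limM Dc Dc) => t.
  by rewrite /indic -natrM mulnb andbb.
move/eqP; rewrite -subr_eq0 -{3}[c]mulr1 -mulrBr mulf_eq0 subr_eq0 => /orP[|] /eqP c01.
  by left; rewrite -c01.
by right; rewrite /almost_all -c01.
Qed.

Lemma almost_all_sub D D' : D `<=` D' -> almost_all D -> almost_all D'.
Proof.
move=> DD' hD; case: (indic_lim D') => // D'0.
have /eqP : 1 = 0 :> K.
  apply: (lim_unique hD); have := limM hD D'0; rewrite mulr0; apply: eq_lim => t.
  rewrite /indic -natrM mulnb; congr (_%:R); congr nat_of_bool.
  by apply/andP/asboolP => [[/asboolP]//|Dt]; split; apply/asboolP => //; exact: DD'.
by rewrite oner_eq0.
Qed.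

Lemma almost_allVC D : almost_all D \/ almost_all (~` D).
Proof.
case: (indic_lim D) => hD; [right|by left].
have := limB (lim_cst 1) hD; rewrite subr0; apply: eq_lim => t.
by rewrite /indic asbool_neg; case: `[< D t >]; rewrite ?subrr ?subr0.
Qed.

Lemma almost_all_forall (I : finType) (D : I -> set T) :
  (forall i, almost_all (D i)) -> almost_all [set t | forall i, D i t].
Proof.
move=> hD; suff : almost_all [set t | forall i, i \in enum I -> D i t].
  by apply: almost_all_sub => t Dt i; apply: Dt; rewrite mem_enum.
elim: (enum I) => [|i s IH]; first by apply: almost_all_sub almost_all_setT.
apply: almost_all_sub (almost_allI (hD i) IH) => t [Dit Dst] j.
by rewrite inE => /predU1P[->|/Dst].
Qed.

(** A relation satisfied by [x] reduces, where [x] vanishes, to its constant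
    term, so that [0] is a root of all the residual relations. *)
Lemma almost_all_lim0 x : almost_all [set t | x t = 0] -> lim x 0.
Proof.
move=> x0; apply: maximal_place_adjoin => // _ [q [Gq qx <-]].
apply/rootP; rewrite horner_coef0 coef_map /=.
have qlim : lim (q`_0).1 (q`_0).2 by rewrite /lim; case: (q`_0) (Gq 0%N).
have := limM qlim x0; rewrite mulr1 => ql.
apply: (lim_unique ql); apply: eq_lim (lim_cst 0) => t.
rewrite /indic; case: asboolP => [/= xt0|]; last by rewrite mulr0.
rewrite mulr1; have := congr1 (fun f => f t) qx.
rewrite (@horner_coef_wide _ (size q).+1) ?fct_sumE; last first.
  exact: leq_trans (size_poly _ _) (leqnSn _).
rewrite big_ord_recl big1 => [|i _].
  by rewrite addr0 coef_map /= expr0 mulr1 => ->.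
by rewrite exprS /GRing.mul /= xt0 mul0r mulr0.
Qed.

Lemma lim_almost x y c : almost_all [set t | x t = y t] -> lim x c -> lim y c.
Proof.
move=> xy xc.
have : lim (fun t => x t - y t) 0.
  by apply: almost_all_lim0; apply: almost_all_sub xy => t /= ->; rewrite subrr.
move=> /(limB xc); rewrite subr0; apply: eq_lim => t.
by rewrite opprB addrC subrK.
Qed.

Lemma finite_almost x y : almost_all [set t | x t = y t] -> finite_at x -> finite_at y.
Proof. by move=> xy [c xc]; exists c; exact: lim_almost xc. Qed.

Lemma lim_neq0_almost x c : lim x c -> c != 0 -> almost_all [set t | x t != 0].
Proof.
move=> xc c0; have := limM xc (limV xc c0); rewrite mulfV //; apply: eq_lim => t.
rewrite /indic; case: asboolP => /= [xt0|/negP/negPn/eqP ->]; first by rewrite mulfV.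
by rewrite mul0r.
Qed.

Lemma finiteM x y : finite_at x -> finite_at y -> finite_at (fun t => x t * y t).
Proof. by move=> [c xc] [c' yc]; exists (c * c'); exact: limM. Qed.

Lemma lim0M x y : lim x 0 -> finite_at y -> lim (fun t => x t * y t) 0.
Proof. by move=> x0 [c yc]; rewrite -(mul0r c); exact: limM. Qed.

Lemma lim_meval n (p : {mpoly K[n]}) (x : 'I_n -> T -> K) (z : 'I_n -> K) :
  (forall i, lim (x i) (z i)) -> lim (fun t => p.@[fun i => x i t]) p.@[z].
Proof.
move=> xz; under eq_fun do rewrite mevalE; rewrite mevalE.
apply: lim_sum => m _; apply: limM; first exact: lim_cst.
by apply: lim_prod => i _; exact: limX.
Qed.

End Limits.

(** The pairs (values of a polynomial along the family, value at [z]) form a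
    partial place exactly when [z] is in the Zariski closure of the family. *)
Lemma adherent_place {T : pointedType} {K : closedFieldType} n
    (x : T -> 'I_n -> K) (z : 'I_n -> K) :
  (forall p : {mpoly K[n]}, (forall t, p.@[x t] = 0) -> p.@[z] = 0) ->
  exists2 G, maximal_place G & forall i, lim G (fun t => x t i) (z i).
Proof.
move=> xz.
pose G0 : set ((T -> K) * K)%type :=
  [set u | exists p : {mpoly K[n]}, u = (fun t => p.@[x t], p.@[z])].
have h0 : partial_place G0.
  constructor.
  - by move=> c; exists c%:MP; congr pair; [apply/funext => t|]; rewrite mevalC.
  - move=> _ _ [p ->] [q ->]; exists (p - q).
    by congr pair => /=; [apply/funext => t|]; rewrite mevalB.
  - move=> _ _ [p ->] [q ->]; exists (p * q).
    by congr pair => /=; [apply/funext => t|]; rewrite mevalM.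
  - by move=> c [p [p0 ->]]; apply: xz => t; rewrite -[LHS]/((fun t => p.@[x t]) t) -p0.
have [G [hG G0G]] := exists_maximal_place h0.
exists G => // i; apply: G0G; exists 'X_i.
by congr pair => /=; [apply/funext => t|]; rewrite mevalXU.
Qed.

(** * Cartan decomposition along a place *)

Section Cartan.
Context {T : pointedType} {K : closedFieldType}.
Variable G : set ((T -> K) * K)%type.
Context (hG : maximal_place G).
Implicit Types (x y : T -> K).

Definition lim_mx m n (k : T -> 'M[K]_(m, n)) (kappa : 'M[K]_(m, n)) : Prop :=
  forall i j, lim G (fun t => k t i j) (kappa i j).
Definition finite_mx m n (k : T -> 'M[K]_(m, n)) : Prop :=
  forall i j, finite_at G (fun t => k t i j).

Lemma finite_mxP m n (k : T -> 'M[K]_(m, n)) :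
  finite_mx k <-> exists kappa, lim_mx k kappa.
Proof.
split=> [fk|[kappa hk] i j]; last by exists (kappa i j).
pose kap i j := sval (cid (fk i j)).
exists (\matrix_(i, j) kap i j) => i j; rewrite mxE.
exact: svalP (cid (fk i j)).
Qed.

Lemma lim_mulmx m n p (k : T -> 'M[K]_(m, n)) (l : T -> 'M[K]_(n, p)) kappa lambda :
  lim_mx k kappa -> lim_mx l lambda ->
  lim_mx (fun t => k t *m l t) (kappa *m lambda).
Proof.
move=> hk hl i j; under eq_fun do rewrite mxE; rewrite mxE.
by apply: lim_sum => // s _; exact: limM.
Qed.

Lemma lim_det n (k : T -> 'M[K]_n) kappa :
  lim_mx k kappa -> lim G (fun t => \det (k t)) (\det kappa).
Proof.
move=> hk; rewrite /determinant; apply: lim_sum => // s _.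
by apply: limM => //; [exact: lim_cst|exact: lim_prod].
Qed.

Lemma lim_adjmx n (k : T -> 'M[K]_n) kappa :
  lim_mx k kappa -> lim_mx (fun t => \adj (k t)) (\adj kappa).
Proof.
move=> hk i j; under eq_fun do rewrite mxE; rewrite mxE.
apply: limM => //; first exact: lim_cst.
by apply: lim_det => a b; under eq_fun do rewrite !mxE; rewrite !mxE; exact: hk.
Qed.

Lemma finite_mulmx m n p (k : T -> 'M[K]_(m, n)) (l : T -> 'M[K]_(n, p)) :
  finite_mx k -> finite_mx l -> finite_mx (fun t => k t *m l t).
Proof.
by move=> /finite_mxP[kappa hk] /finite_mxP[lambda hl]; apply/finite_mxP;
   exists (kappa *m lambda); exact: lim_mulmx.
Qed.

Lemma finite_adjmx n (k : T -> 'M[K]_n) :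
  finite_mx k -> finite_mx (fun t => \adj (k t)).
Proof.
by move=> /finite_mxP[kappa hk]; apply/finite_mxP; exists (\adj kappa); exact: lim_adjmx.
Qed.

Lemma finite_mx_cst m n (k : 'M[K]_(m, n)) : finite_mx (fun=> k).
Proof. by move=> i j; exists (k i j); exact: lim_cst. Qed.

Lemma finite_mxN m n (k : T -> 'M[K]_(m, n)) :
  finite_mx k -> finite_mx (fun t => - k t).
Proof.
move=> fk i j; have [c kc] := fk i j; exists (- c).
by under eq_fun do rewrite mxE; exact: limN.
Qed.

Lemma finite_block_mx m1 m2 n1 n2 (A : T -> 'M[K]_(m1, n1)) (B : T -> 'M[K]_(m1, n2))
    (C : T -> 'M[K]_(m2, n1)) (D : T -> 'M[K]_(m2, n2)) :
  finite_mx A -> finite_mx B -> finite_mx C -> finite_mx D ->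
  finite_mx (fun t => block_mx (A t) (B t) (C t) (D t)).
Proof.
move=> fA fB fC fD i j; under eq_fun do rewrite mxE.
by case: (fintype.split i) => i'; under eq_fun do rewrite mxE;
  case: (fintype.split j) => j'.
Qed.

(** The order on valuations; up to null sets, since [y] may vanish. *)
Definition dominated x y : Prop :=
  exists2 o, finite_at G o & almost_all G [set t | x t = o t * y t].

Lemma dominated_refl x : dominated x x.
Proof.
exists (fun=> 1); first by exists 1; exact: lim_cst.
by apply: almost_all_sub (almost_all_setT hG) => // t _ /=; rewrite mul1r.
Qed.

Lemma dominated_trans x y z : dominated x y -> dominated y z -> dominated x z.
Proof.
move=> [o fo xy] [o' fo' yz]; exists (fun t => o t * o' t); first exact: finiteM.
by apply: almost_all_sub (almost_allI hG xy yz) => // t /= [-> ->]; rewrite mulrA.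
Qed.

Lemma dominated_total x y : dominated x y \/ dominated y x.
Proof.
have dom x' y' : finite_at G (fun t => x' t / y' t) -> dominated x' y' \/ dominated y' x'.
  move=> fxy; case: (almost_allVC hG [set t | y' t = 0]) => y0.
    right; exists (fun=> 0); first by exists 0; exact: lim_cst.
    by apply: almost_all_sub y0 => // t /= ->; rewrite mul0r.
  left; exists (fun t => x' t / y' t) => //.
  by apply: almost_all_sub y0 => // t /= /eqP yt0; rewrite divfK.
case: (finite_or_inv0 hG (fun t => x t / y t)) => [/dom//|yx0].
apply/or_comm/dom; exists 0; apply: eq_lim yx0 => t; by rewrite invf_div.
Qed.

Lemma dominant_entry (I : finType) (i0 : I) (x : I -> T -> K) :
  exists i, forall j, dominated (x j) (x i).
Proof.
suff [i hi] : exists i, forall j, j \in i0 :: enum I -> dominated (x j) (x i).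
  by exists i => j; apply: hi; rewrite inE mem_enum orbT.
elim: (enum I) => [|i s [m hm]].
  by exists i0 => j; rewrite inE => /eqP ->; exact: dominated_refl.
have [im|mi] := dominated_total (x i) (x m).
  by exists m => j; rewrite !inE orbCA => /predU1P[->//|js]; apply: hm; rewrite inE.
exists i => j; rewrite !inE orbCA => /predU1P[->|js]; first exact: dominated_refl.
by apply: dominated_trans mi; apply: hm; rewrite inE.
Qed.

Definition integral_gl n (k : T -> 'M[K]_n) : Prop :=
  finite_mx k /\ exists2 k', finite_mx k' & forall t, k t *m k' t = 1%:M.

Lemma integral_glM n (k l : T -> 'M[K]_n) :
  integral_gl k -> integral_gl l -> integral_gl (fun t => k t *m l t).
Proof.
move=> [fk [k' fk' kk']] [fl [l' fl' ll']]; split; first exact: finite_mulmx.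
exists (fun t => l' t *m k' t); first exact: finite_mulmx.
by move=> t; rewrite mulmxA -(mulmxA (k t)) ll' mulmx1.
Qed.

Lemma integral_gl_tperm n (i j : 'I_n) : integral_gl (fun=> tperm_mx i j).
Proof.
split; first exact: finite_mx_cst.
by exists (fun=> tperm_mx i j) => [|t]; [exact: finite_mx_cst|exact: tperm_mxK].
Qed.

(** Elimination over a valuation ring: move an entry that dominates all others
    to the corner; the rest of its row and column are finite multiples of it
    and can be cleared by finite unipotent matrices. *)
Lemma cartan_gl n (h : T -> 'M[K]_n) :
  exists k1 k2 (a : T -> 'rV[K]_n), [/\ integral_gl k1, integral_gl k2 &
    almost_all G [set t | h t = k1 t *m diag_mx (a t) *m k2 t]].
Proof.
elim: n h => [|n IH] h.
  exists (fun=> 1%:M), (fun=> 1%:M), (fun=> 0).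
  have I1 : integral_gl (fun=> 1%:M : 'M[K]_0).
    split; first exact: finite_mx_cst.
    by exists (fun=> 1%:M) => [|t]; [exact: finite_mx_cst|exact: mulmx1].
  split=> //; apply: almost_all_sub (almost_all_setT hG) => // t _.
  by apply/matrixP => - [].
have [[i j] hij] := dominant_entry (ord0, ord0) (fun ij t => h t ij.1 ij.2).
pose h' t : 'M[K]_(1 + n) := tperm_mx i ord0 *m h t *m tperm_mx ord0 j.
have h'E t u v : h' t u v = h t (tperm i ord0 u) (tperm ord0 j v).
  by rewrite /h' -xrowE -xcolE !mxE.
have h'00 t : h' t ord0 ord0 = h t i j by rewrite h'E tpermR tpermL.
have hh' t : h t = tperm_mx i ord0 *m h' t *m tperm_mx ord0 j.
  by rewrite /h' !mulmxA tperm_mxK mul1mx -mulmxA tperm_mxK mulmx1.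
clearbody h'.
have dom u v : dominated (fun t => h' t u v) (fun t => h' t ord0 ord0).
  have [o fo ho] := hij (tperm i ord0 u, tperm ord0 j v); exists o => //.
  by apply: almost_all_sub ho => // t /=; rewrite h'00 h'E.
pose o u v := s2val (cid2 (dom u v)).
have fo u v : finite_at G (o u v) := s2valP (cid2 (dom u v)).
have ho u v : almost_all G [set t | h' t u v = o u v t * h' t ord0 ord0] :=
  s2valP' (cid2 (dom u v)).
pose p t : 'M[K]_1 := (h' t ord0 ord0)%:M.
pose c t : 'cV[K]_n := \col_u o (rshift 1 u) ord0 t.
pose r t : 'rV[K]_n := \row_v o ord0 (rshift 1 v) t.
have fc : finite_mx c by move=> u v; under eq_fun do rewrite mxE.
have fr : finite_mx r by move=> u v; under eq_fun do rewrite mxE.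
have [l1 [l2 [a [gl1 gl2 la]]]] := IH (fun t => drsubmx (h' t) - c t *m p t *m r t).
have f1 : finite_mx (fun=> 1%:M : 'M[K]_1) := finite_mx_cst _.
have f0 m1 n1 : finite_mx (fun=> 0 : 'M[K]_(m1, n1)) := finite_mx_cst _.
have fn1 : finite_mx (fun=> 1%:M : 'M[K]_n) := finite_mx_cst _.
have glc : integral_gl (fun t => block_mx 1%:M 0 (c t) 1%:M : 'M[K]_(1 + n)).
  split; first exact: finite_block_mx.
  exists (fun t => block_mx 1%:M 0 (- c t) 1%:M) => [|t].
    by apply: finite_block_mx => //; exact: finite_mxN.
  by rewrite mulmx_block !(mulmx0, mul0mx, mulmx1, mul1mx, addr0, add0r) subrr -scalar_mx_block.
have glr : integral_gl (fun t => block_mx 1%:M (r t) 0 1%:M : 'M[K]_(1 + n)).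
  split; first exact: finite_block_mx.
  exists (fun t => block_mx 1%:M (- r t) 0 1%:M) => [|t].
    by apply: finite_block_mx => //; exact: finite_mxN.
  by rewrite mulmx_block !(mulmx0, mul0mx, mulmx1, mul1mx, addr0, add0r) addNr -scalar_mx_block.
have glblock l : integral_gl l ->
    integral_gl (fun t => block_mx 1%:M 0 0 (l t) : 'M[K]_(1 + n)).
  move=> [fl [l' fl' ll']]; split; first exact: finite_block_mx.
  exists (fun t => block_mx 1%:M 0 0 (l' t)) => [|t]; first exact: finite_block_mx.
  by rewrite mulmx_block !(mulmx0, mul0mx, mulmx1, mul1mx, addr0, add0r) ll' -scalar_mx_block.
exists (fun t => tperm_mx i ord0 *m (block_mx 1%:M 0 (c t) 1%:M *m block_mx 1%:M 0 0 (l1 t))).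
exists (fun t => block_mx 1%:M 0 0 (l2 t) *m block_mx 1%:M (r t) 0 1%:M *m tperm_mx ord0 j).
exists (fun t => row_mx (h' t ord0 ord0)%:M (a t)); split.
- apply: integral_glM; first exact: integral_gl_tperm.
  by apply: integral_glM => //; exact: glblock.
- apply: integral_glM; last exact: integral_gl_tperm.
  by apply: integral_glM => //; exact: glblock.
have hoall : almost_all G [set t | forall uv : 'I_(1 + n) * 'I_(1 + n),
    h' t uv.1 uv.2 = o uv.1 uv.2 t * h' t ord0 ord0].
  by apply: almost_all_forall => // -[u v]; exact: ho.
apply: almost_all_sub (almost_allI hG hoall la) => // t [hot lat] /=.
rewrite hh' -!mulmxA; congr (_ *m _); rewrite !mulmxA; congr (_ *m _).
have hot' u v : h' t u v = o u v t * h' t ord0 ord0 := hot (u, v).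
rewrite [LHS](_ : _ = block_mx (p t) (p t *m r t) (c t *m p t) (drsubmx (h' t))); last first.
  rewrite -{1}[h' t]submxK; congr block_mx; apply/matrixP => u v; rewrite !mxE.
  - by rewrite !ord1 eqxx mulr1n !lshift0.
  - by rewrite big_ord1 !mxE !ord1 !lshift0 eqxx mulr1n [LHS]hot' mulrC.
  - by rewrite big_ord1 !mxE !ord1 !lshift0 eqxx mulr1n [LHS]hot'.
have dE : diag_mx (row_mx (p t) (a t)) = block_mx (p t) 0 0 (diag_mx (a t)) :> 'M_(1 + n).
  rewrite diag_mx_row; congr block_mx.
  by apply/matrixP => u v; rewrite !mxE !ord1 eqxx.
rewrite [diag_mx _]dE.
suff : block_mx (p t) (p t *m r t) (c t *m p t) (drsubmx (h' t)) =
    block_mx 1%:M 0 (c t) 1%:M *m block_mx 1%:M 0 0 (l1 t) *m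
    block_mx (p t) 0 0 (diag_mx (a t)) *m block_mx 1%:M 0 0 (l2 t) *m
    block_mx 1%:M (r t) 0 1%:M :> 'M_(1 + n) by [].
rewrite !mulmx_block !(mulmx0, mul0mx, mulmx1, mul1mx, addr0, add0r).
congr block_mx.
by rewrite -lat addrC subrK.
Qed.

Lemma integral_gl_det n (k : T -> 'M[K]_n) : integral_gl k ->
  finite_at G (fun t => (\det (k t))^-1) /\ forall t, \det (k t) != 0.
Proof.
move=> [fk [k' fk' kk']].
have dd t : \det (k t) * \det (k' t) = 1 by rewrite -det_mulmx kk' det1.
have d0 t : \det (k t) != 0.
  by apply/eqP => d0; move: (dd t) => /eqP; rewrite d0 mul0r eq_sym oner_eq0.
split=> //; have [kappa' hk'] := (finite_mxP k').1 fk'; exists (\det kappa').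
apply: eq_lim (lim_det hk') => t; apply: (mulfI (d0 t)).
by rewrite dd mulfV.
Qed.

(** Used to move the determinants of the outer factors into the diagonal one. *)
Definition scale_head n (c : K) : 'rV[K]_n.+1 := \row_i (if i == ord0 then c else 1).

Lemma det_scale_head n c : \det (diag_mx (scale_head n c)) = c.
Proof.
rewrite det_diag big_ord_recl mxE eqxx big1 ?mulr1 // => i _.
by rewrite mxE.
Qed.

Lemma finite_scale_head n (c : T -> K) : finite_at G c ->
  finite_mx (fun t => diag_mx (scale_head n (c t))).
Proof.
move=> fc i j; have [<-|ij] := eqVneq i j.
  under eq_fun do rewrite !mxE eqxx mulr1n.
  by case: (i == ord0) => //; exists 1; exact: lim_cst.
by exists 0; apply: eq_lim (lim_cst hG 0) => t; rewrite mxE (negbTE ij).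
Qed.

(** The determinants of [k1], [k2] and the product of the [a i] are normalized
    for all parameters; only the factorization is restricted to almost all. *)
Lemma cartan_sl n (h : T -> 'M[K]_n.+1) : (forall t, \det (h t) = 1) ->
  exists k1 k2 (a : T -> 'rV[K]_n.+1),
  [/\ finite_mx k1 /\ (forall t, \det (k1 t) = 1),
      finite_mx k2 /\ (forall t, \det (k2 t) = 1),
      forall t, \prod_i a t 0 i = 1 &
      almost_all G [set t | h t = k1 t *m diag_mx (a t) *m k2 t]].
Proof.
move=> h1; have [k1 [k2 [a [gl1 gl2 ha]]]] := cartan_gl h.
have [fd1 d1] := integral_gl_det gl1; have [fd2 d2] := integral_gl_det gl2.
pose s1 t := scale_head n (\det (k1 t)); pose s2 t := scale_head n (\det (k2 t)).
pose s1' t := scale_head n (\det (k1 t))^-1; pose s2' t := scale_head n (\det (k2 t))^-1.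
have s1K t : diag_mx (s1' t) *m diag_mx (s1 t) = 1%:M.
  rewrite mulmx_diag -diag_const_mx; congr diag_mx; apply/matrixP => i j.
  by rewrite !mxE; case: eqP => _; rewrite ?mulr1 // mulVf.
have s2K t : diag_mx (s2 t) *m diag_mx (s2' t) = 1%:M.
  rewrite mulmx_diag -diag_const_mx; congr diag_mx; apply/matrixP => i j.
  by rewrite !mxE; case: eqP => _; rewrite ?mulr1 // mulfV.
pose b t := \row_i (s1 t 0 i * a t 0 i * s2 t 0 i).
have bE t : diag_mx (b t) = diag_mx (s1 t) *m diag_mx (a t) *m diag_mx (s2 t).
  by rewrite !mulmx_diag; congr diag_mx; apply/matrixP => i j; rewrite !mxE.
exists (fun t => k1 t *m diag_mx (s1' t)), (fun t => diag_mx (s2' t) *m k2 t).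
exists (fun t => if \prod_i b t 0 i == 1 then b t else const_mx 1); split.
- split; first by apply: finite_mulmx; [exact: gl1.1|exact: finite_scale_head].
  by move=> t; rewrite det_mulmx det_scale_head mulfV.
- split; first by apply: finite_mulmx; [exact: finite_scale_head|exact: gl2.1].
  by move=> t; rewrite det_mulmx det_scale_head mulVf.
- move=> t; case: eqP => // _; apply: big1 => i _; by rewrite mxE.
apply: almost_all_sub ha => // t /= ht.
have hb : h t = k1 t *m diag_mx (s1' t) *m diag_mx (b t) *m (diag_mx (s2' t) *m k2 t).
  rewrite bE !mulmxA -[k1 t *m _ *m _]mulmxA s1K mulmx1.
  by rewrite -[_ *m diag_mx (s2 t) *m _]mulmxA s2K mulmx1.
suff -> : \prod_i b t 0 i == 1 by [].
move: (h1 t); rewrite {1}hb !det_mulmx !det_scale_head det_diag.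
by rewrite mulfV // mulVf // mul1r mulr1 => ->.
Qed.

End Cartan.

(** * The action on ternary forms *)

Section FormAction.
Context {K : fieldType} {d : nat}.
Implicit Types (f : ternary_form K d) (g : 'M[K]_3).

Lemma comp_mpolyA n m k (p : {mpoly K[n]}) (lq : n.-tuple {mpoly K[m]})
    (lr : m.-tuple {mpoly K[k]}) :
  (p \mPo lq) \mPo lr = p \mPo [tuple tnth lq i \mPo lr | i < n].
Proof.
rewrite (comp_mpolyEX p lq) (comp_mpolyEX p) raddf_sum; apply: eq_bigr => mm _ /=.
rewrite comp_mpolyZ !comp_mpolyX rmorph_prod /=; congr (_ *: _).
by apply: eq_bigr => i _; rewrite rmorphXn /= tnth_mktuple.
Qed.

Lemma form_actM g1 g2 f : g1 \in unitmx -> g2 \in unitmx ->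
  form_act (g1 *m g2) f = form_act g1 (form_act g2 f).
Proof.
move=> u1 u2; apply: val_inj; rewrite /= comp_mpolyA; congr (_ \mPo _).
apply: eq_from_tnth => i; rewrite !tnth_mktuple raddf_sum /=.
under [RHS]eq_bigr do rewrite comp_mpolyZ comp_mpolyXU -tnth_nth tnth_mktuple scaler_sumr.
rewrite exchange_big /=; apply: eq_bigr => k _.
rewrite invmxM // mxE scaler_suml; apply: eq_bigr => j _.
by rewrite scalerA.
Qed.

Lemma form_act1 f : form_act 1%:M f = f.
Proof.
apply: val_inj; rewrite /= -[RHS]comp_mpoly_id; congr (_ \mPo _).
apply: eq_from_tnth => i; rewrite !tnth_mktuple invmx1 (bigD1 i) //= big1 => [|j ji].
  by rewrite mxE eqxx scale1r addr0.
by rewrite mxE eq_sym (negbTE ji) scale0r.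
Qed.

(** The inverses come from the action: [g] acts by substituting [g^-1]. *)
Definition weight (a : 'rV[K]_3) (m : 'X_{1..3}) : K := \prod_i (a 0 i)^-1 ^+ m i.

Lemma form_act_diag (a : 'rV[K]_3) f (m : 'X_{1..3}) : (forall i, a 0 i != 0) ->
  (form_act (diag_mx a) f : {mpoly K[3]})@_m = weight a m * (f : {mpoly K[3]})@_m.
Proof.
move=> a0; have -> : val (form_act (diag_mx a) f) = \sum_(k <- msupp f)
    (weight a k * (f : {mpoly K[3]})@_k) *: 'X_[k].
  rewrite /= comp_mpolyEX; apply: eq_bigr => k _; rewrite comp_mpolyX.
  rewrite [weight a k * _]mulrC -scalerA; congr (_ *: _).
  have tn i : tnth (lin_subst (diag_mx a)) i = (a 0 i)^-1 *: 'X_i.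
    have aV : invmx (diag_mx a) = diag_mx (\row_i (a 0 i)^-1).
      have ua : diag_mx a \in unitmx.
        by rewrite unitmxE det_diag unitfE prodf_seq_neq0; apply/allP => j _ /=.
      rewrite -[RHS](mulKmx ua) mulmx_diag (_ : \row_j _ = const_mx 1).
        by rewrite diag_const_mx mulmx1.
      by apply/matrixP => u j; rewrite !mxE mulfV.
    rewrite tnth_mktuple aV (bigD1 i) //= big1 ?addr0 => [|j ji].
      by rewrite !mxE eqxx.
    by rewrite !mxE eq_sym (negbTE ji) mulr0n scale0r.
  under eq_bigr do rewrite tn exprZn.
  by rewrite scaler_prod -mpolyXE_id.
rewrite raddf_sum /=.
have [mf|mf] := boolP (m \in msupp f); last first.
  rewrite (memN_msupp_eq0 mf) mulr0 big_seq big1 // => k kf.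
  rewrite mcoeffZ mcoeffX; case: eqP => [km|_]; rewrite ?mulr0 //.
  by rewrite -km kf in mf.
rewrite (bigD1_seq m) ?msupp_uniq //= big1 => [|k km].
  by rewrite mcoeffZ mcoeffX eqxx mulr1 addr0.
by rewrite mcoeffZ mcoeffX (negbTE km) mulr0.
Qed.

Lemma msize_form f : (msize f <= d.+1)%N.
Proof.
rewrite msizeE; apply/bigmax_leqP_seq => m mf _; rewrite ltnS.
by have /dhomogP -> := dhomog_is_dhomog f.
Qed.

Lemma form_coeff0 f (m : 'X_{1..3}) : mdeg m != d -> (f : {mpoly K[3]})@_m = 0.
Proof. exact/dhomog_nemf_coeff/dhomog_is_dhomog. Qed.

Lemma form_eqP f f' : (forall m : 'X_{1..3}, mdeg m = d ->
  (f : {mpoly K[3]})@_m = (f' : {mpoly K[3]})@_m) -> f = f'.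
Proof.
move=> ff'; apply/val_inj/mpolyP => m /=.
by have [/ff'//|/[dup]/form_coeff0-> /form_coeff0->] := eqVneq (mdeg m) d.
Qed.

Definition monomial_form (m : 'X_{1..3}) : ternary_form K d :=
  insubd (0 : dhomog 3 K d) 'X_[m].

Definition form_of_coeffs (c : 'X_{1..3} -> K) : ternary_form K d :=
  \sum_(m : 'X_{1..3 < d.+1} | mdeg m == d) c m *: monomial_form m.

Lemma form_of_coeffsE c (m : 'X_{1..3}) : mdeg m = d ->
  (form_of_coeffs c : {mpoly K[3]})@_m = c m.
Proof.
move=> md; rewrite /form_of_coeffs.
have mX (k : 'X_{1..3}) : mdeg k = d -> (monomial_form k : {mpoly K[3]}) = 'X_[k].
  by move=> kd; rewrite -[LHS]/(val _) val_insubd dhomogX /= kd eqxx.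
have cE (k : 'X_{1..3}) : mdeg k = d ->
    mcoeff m (mpoly_of_dhomog (c k *: monomial_form k)) = c k * (k == m)%:R.
  by move=> kd; rewrite [mpoly_of_dhomog _]linearZ /= mcoeffZ [X in X@_m]mX // mcoeffX.
have mb : (mdeg m < d.+1)%N by rewrite md.
rewrite !linear_sum /= (bigD1 (BMultinom mb)) /= ?md // big1 => [|k /andP[/eqP kd km]].
  by rewrite cE // eqxx mulr1 addr0.
rewrite cE //; case: eqP => [km'|_]; rewrite ?mulr0 //.
by case/eqP: km; apply: val_inj.
Qed.

Lemma form_of_coeffsK f : form_of_coeffs (fun m => (f : {mpoly K[3]})@_m) = f.
Proof. by apply: form_eqP => m /form_of_coeffsE. Qed.

End FormAction.

(** * Limits of forms *)

Section FormLimits.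
Context {T : pointedType} {K : closedFieldType}.
Variable G : set ((T -> K) * K)%type.
Context (hG : maximal_place G).

(** The two instances in use are the valuation ring and its maximal ideal; with
    them the semistable and the stable case are treated together. *)
Record fractional_ideal (F : (T -> K) -> Prop) : Prop := FractionalIdeal {
  fi_almost : forall x y, almost_all G [set t | x t = y t] -> F x -> F y;
  fi0 : F (fun=> 0);
  fiD : forall x y, F x -> F y -> F (fun t => x t + y t);
  fiM : forall x y, F x -> finite_at G y -> F (fun t => x t * y t);
  fi_or_inv : forall x, F x \/ finite_at G (fun t => (x t)^-1) }.

Lemma fractional_ideal_finite : fractional_ideal (finite_at G).
Proof.
constructor.
- by move=> x y; exact: finite_almost.
- by exists 0; exact: lim_cst.
- by move=> x y [c xc] [c' yc]; exists (c + c'); exact: limD.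
- by move=> x y; exact: finiteM.
- by move=> x; case: (finite_or_inv0 hG x) => [|x0]; [left|right; exists 0].
Qed.

Lemma fractional_ideal_lim0 : fractional_ideal (fun x => lim G x 0).
Proof.
constructor.
- by move=> x y; exact: lim_almost.
- exact: lim_cst.
- by move=> x y x0 y0; rewrite -(addr0 0); exact: limD.
- by move=> x y; exact: lim0M.
- move=> x; case: (finite_or_inv0 hG (fun t => (x t)^-1)) => [|x0]; first by right.
  by left; apply: eq_lim x0 => t; rewrite invrK.
Qed.

Lemma fi_sum F I (r : seq I) (P : pred I) (x : I -> T -> K) : fractional_ideal F ->
  (forall i, P i -> F (x i)) -> F (fun t => \sum_(i <- r | P i) x i t).
Proof.
move=> hF Fx; elim: r => [|i r IH].
  by under eq_fun do rewrite big_nil; exact: fi0.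
under eq_fun do rewrite big_cons.
by have [Pi|//] := boolP (P i); apply: fiD => //; exact: Fx.
Qed.

Lemma fi_cancel F x y c : fractional_ideal F -> F (fun t => x t * y t) ->
  lim G y c -> c != 0 -> F x.
Proof.
move=> hF Fxy yc c0.
have fy : finite_at G (fun t => (y t)^-1) by exists c^-1; exact: limV.
apply: (fi_almost hF) (fiM hF Fxy fy).
by apply: almost_all_sub (lim_neq0_almost hG yc c0) => // t /= yt; rewrite mulfK.
Qed.

Definition lim_mpoly n (p : T -> {mpoly K[n]}) (q : {mpoly K[n]}) : Prop :=
  forall m, lim G (fun t => (p t)@_m) q@_m.

Lemma lim_mpolyM n (p p' : T -> {mpoly K[n]}) q q' :
  lim_mpoly p q -> lim_mpoly p' q' -> lim_mpoly (fun t => p t * p' t) (q * q').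
Proof.
move=> pq pq' m; under eq_fun do rewrite mcoeffM; rewrite mcoeffM.
by apply: lim_sum => // k _; exact: limM.
Qed.

Lemma lim_mpoly_cst n (q : {mpoly K[n]}) : lim_mpoly (fun=> q) q.
Proof. by move=> m; exact: lim_cst. Qed.

Lemma lim_mpolyX n (p : T -> {mpoly K[n]}) q e :
  lim_mpoly p q -> lim_mpoly (fun t => p t ^+ e) (q ^+ e).
Proof.
move=> pq; elim: e => [|e IH]; first exact: lim_mpoly_cst.
by under eq_fun do rewrite exprS; rewrite exprS; exact: lim_mpolyM.
Qed.

Lemma lim_mpoly_prod n I (r : seq I) (p : I -> T -> {mpoly K[n]}) q :
  (forall i, lim_mpoly (p i) (q i)) ->
  lim_mpoly (fun t => \prod_(i <- r) p i t) (\prod_(i <- r) q i).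
Proof.
move=> pq; elim: r => [|i r IH].
  by under eq_fun do rewrite big_nil; rewrite big_nil; exact: lim_mpoly_cst.
by under eq_fun do rewrite big_cons; rewrite big_cons; exact: lim_mpolyM.
Qed.

(** The action of [g] on the monomial [m]; its coefficients are the matrix
    entries of the representation on forms. *)
Definition monomial_subst (g : 'M[K]_3) (m : 'X_{1..3}) : {mpoly K[3]} :=
  \prod_(i < 3) tnth (lin_subst g) i ^+ m i.

Lemma lim_det1 n (k : T -> 'M[K]_n) kappa : lim_mx G k kappa ->
  (forall t, \det (k t) = 1) -> \det kappa = 1.
Proof.
move=> kk k1; apply: (lim_unique hG (lim_det hG kk)).
by under eq_fun do rewrite k1; exact: lim_cst.
Qed.

Lemma lim_monomial_subst (k : T -> 'M[K]_3) kappa m : lim_mx G k kappa ->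
  (forall t, \det (k t) = 1) ->
  lim_mpoly (fun t => monomial_subst (k t) m) (monomial_subst kappa m).
Proof.
move=> kk k1; apply: lim_mpoly_prod => i; apply: lim_mpolyX => n.
have kappa1 := lim_det1 kk k1.
under eq_fun do rewrite tnth_mktuple invmx_sl // raddf_sum /=.
rewrite tnth_mktuple invmx_sl // raddf_sum /=.
apply: lim_sum => // j _; under eq_fun do rewrite mcoeffZ; rewrite mcoeffZ.
by apply: limM => //; [exact: lim_adjmx|exact: lim_cst].
Qed.

Section Degree.
Context {d : nat}.
Implicit Types (u : T -> ternary_form K d) (v : ternary_form K d).

Definition lim_form u v : Prop :=
  forall m : 'X_{1..3}, lim G (fun t => (u t : {mpoly K[3]})@_m) (v : {mpoly K[3]})@_m.
Definition coeffs_in (F : (T -> K) -> Prop) u : Prop :=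
  forall m : 'X_{1..3}, F (fun t => (u t : {mpoly K[3]})@_m).

Lemma finite_formP u : coeffs_in (finite_at G) u -> exists v, lim_form u v.
Proof.
move=> fu; pose c m := sval (cid (fu m)).
have uc m : lim G (fun t => (u t : {mpoly K[3]})@_m) (c m) := svalP (cid (fu m)).
exists (form_of_coeffs c) => m; have [md|md] := eqVneq (mdeg m) d.
  by rewrite form_of_coeffsE.
by rewrite form_coeff0 //; under eq_fun do rewrite form_coeff0 //; exact: lim_cst.
Qed.

Lemma form_act_coeff (g : 'M[K]_3) v (m : 'X_{1..3}) :
  (form_act g v : {mpoly K[3]})@_m =
  \sum_(k : 'X_{1..3 < d.+1}) (v : {mpoly K[3]})@_k * (monomial_subst g k)@_m.
Proof.
rewrite /= (comp_mpolywE _ (msize_form v)) raddf_sum /=.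
by apply: eq_bigr => k _; rewrite mcoeffZ.
Qed.

Lemma lim_form_act u v (k : T -> 'M[K]_3) kappa : lim_form u v ->
  lim_mx G k kappa -> (forall t, \det (k t) = 1) ->
  lim_form (fun t => form_act (k t) (u t)) (form_act kappa v).
Proof.
move=> uv kk k1 m; under eq_fun do rewrite form_act_coeff; rewrite form_act_coeff.
by apply: lim_sum => // i _; apply: limM => //; exact: lim_monomial_subst.
Qed.

Lemma coeffs_in_act F u (k : T -> 'M[K]_3) : fractional_ideal F -> coeffs_in F u ->
  finite_mx G k -> (forall t, \det (k t) = 1) ->
  coeffs_in F (fun t => form_act (k t) (u t)).
Proof.
move=> hF Fu /(finite_mxP _ _)[kappa kk] k1 m; under eq_fun do rewrite form_act_coeff.
apply: fi_sum => // i _; apply: fiM => //.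
by exists (monomial_subst kappa i)@_m; exact: lim_monomial_subst.
Qed.

Lemma coeffs_in_coord F u : fractional_ideal F ->
  (forall i, F (fun t => coord (vbasis {: ternary_form K d}) i (u t))) -> coeffs_in F u.
Proof.
move=> hF Fu m; pose e := vbasis {: ternary_form K d}.
have uE t : (u t : {mpoly K[3]})@_m = \sum_i coord e i (u t) * (e`_i : {mpoly K[3]})@_m.
  rewrite {1}(coord_vbasis (memvf (u t))) !raddf_sum /=.
  by apply: eq_bigr => i _; rewrite [X in X@_m]linearZ /= mcoeffZ.
under eq_fun do rewrite uE; apply: fi_sum => // i _.
by apply: fiM => //; exists (e`_i : {mpoly K[3]})@_m; exact: lim_cst.
Qed.

End Degree.

Definition lim_vec (W : vectType K) (u : T -> W) (v : W) : Prop :=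
  forall i, lim G (fun t => coord (vbasis {: W}) i (u t)) (coord (vbasis {: W}) i v).

Lemma lim_form_vec d (u : T -> ternary_form K d) v : lim_form u v -> lim_vec u v.
Proof.
move=> uv i; pose e := vbasis {: ternary_form K d}.
have vE (w : ternary_form K d) : coord e i w =
    \sum_(m : 'X_{1..3 < d.+1} | mdeg m == d) (w : {mpoly K[3]})@_m * coord e i (monomial_form m).
  rewrite -{1}[w]form_of_coeffsK /form_of_coeffs linear_sum /=.
  by apply: eq_bigr => m _; rewrite linearZ.
under eq_fun do rewrite -/e vE; rewrite -/e vE.
by apply: lim_sum => // m _; apply: limM => //; exact: lim_cst.
Qed.

(** Limits along a place stay in the Zariski closure: apply the place to the
    equations of the closure. *)
Lemma lim_vec_closure (W : vectType K) (A : set W) (u : T -> W) v :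
  lim_vec u v -> (forall t, A (u t)) -> zariski_closure A v.
Proof.
move=> uv Au Z [[S ->] AZ] p Sp; rewrite /poly_fun.
apply: (lim_unique hG (lim_meval hG p uv)).
by under eq_fun => t do rewrite [_.@[_]](AZ _ (Au t) p Sp); exact: lim_cst.
Qed.

End FormLimits.

(** * Members of a pencil *)

Section Pencils.
Context {T : pointedType} {K : closedFieldType}.
Variable G : set ((T -> K) * K)%type.
Context (hG : maximal_place G).

Lemma dominated_fi F x y : fractional_ideal G F -> dominated G x y -> F y -> F x.
Proof.
move=> hF [o fo xy] Fy; apply: (fi_almost hF) (fiM hF Fy fo).
by apply: almost_all_sub xy => // t /= ->; rewrite mulrC.
Qed.

(** The core of the passage from a pencil to a member.  With [x j] the pivot,
    either it is in [F] and so is every entry, or its inverse is finite and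
    clearing the column [j] of the second row leaves minors divided by the
    pivot. *)
Lemma primitive_combination_dominant F (I : finType) (x y : I -> T -> K) (j : I) :
  fractional_ideal G F ->
  (forall i, dominated G (x i) (x j)) -> (forall i, dominated G (y i) (x j)) ->
  (forall i k, F (fun t => x i t * y k t - x k t * y i t)) ->
  exists alpha alpha0 beta beta0, [/\ lim G alpha alpha0, lim G beta beta0,
    alpha0 != 0 \/ beta0 != 0 & forall i, F (fun t => alpha t * x i t + beta t * y i t)].
Proof.
move=> hF xx yx Fxy.
have small : F (x j) -> exists alpha alpha0 beta beta0, [/\ lim G alpha alpha0, lim G beta beta0,
    alpha0 != 0 \/ beta0 != 0 & forall i, F (fun t => alpha t * x i t + beta t * y i t)].
  move=> Fxj; exists (fun=> 1), 1, (fun=> 0), 0; split; try exact: lim_cst.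
    by left; rewrite oner_neq0.
  move=> i; under eq_fun do rewrite mul1r mul0r addr0.
  exact: dominated_fi (xx i) Fxj.
have [/small//|fV] := fi_or_inv hF (x j).
have [xj0|xj0] := almost_allVC hG [set t | x j t = 0].
  apply: small; apply: (fi_almost hF) (fi0 hF).
  by apply: almost_all_sub xj0 => // t /= ->.
have [o [o0 oo0] yo] := yx j.
exists (fun t => - o t), (- o0), (fun=> 1), 1; split; [exact: limN|exact: lim_cst| |].
  by right; rewrite oner_neq0.
move=> i; apply: (fi_almost hF) (fiM hF (Fxy j i) fV).
apply: almost_all_sub (almost_allI hG xj0 yo) => // t /= [/eqP xjt0 ->].
by field.
Qed.

(** The dominant entry may lie in either row; exchanging the rows only changes
    the sign of the minors. *)
Lemma primitive_combination F (I : finType) (x y : I -> T -> K) :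
  fractional_ideal G F ->
  (forall i k, F (fun t => x i t * y k t - x k t * y i t)) ->
  exists alpha alpha0 beta beta0, [/\ lim G alpha alpha0, lim G beta beta0,
    alpha0 != 0 \/ beta0 != 0 & forall i, F (fun t => alpha t * x i t + beta t * y i t)].
Proof.
move=> hF Fxy; have [i0 _|nI] := pickP (@predT I); last first.
  exists (fun=> 1), 1, (fun=> 0), 0; split; try exact: lim_cst.
    by left; rewrite oner_neq0.
  by move=> i; have := nI i.
pose z (bi : bool * I) := if bi.1 then y bi.2 else x bi.2.
have [[b j] hj] := dominant_entry hG (false, i0) z.
case: b hj => hj; last first.
  by apply: (primitive_combination_dominant (j := j)) => // i;
    [exact: (hj (false, i))|exact: (hj (true, i))].
have Fyx i k : F (fun t => y i t * x k t - y k t * x i t).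
  apply: (fi_almost hF) (Fxy k i).
  by apply: almost_all_sub (almost_all_setT hG) => // t _ /=; ring.
have [b [b0 [a [a0 [hb ha ab Fab]]]]] := primitive_combination_dominant hF
  (fun i => hj (true, i)) (fun i => hj (false, i)) Fyx.
exists a, a0, b, b0; split=> //; first by case: ab; [right|left].
by move=> i; have := Fab i; congr F; apply/funext => t; rewrite addrC.
Qed.

Lemma form_coeff_comb d (a b : K) (f f' : ternary_form K d) (m : 'X_{1..3}) :
  (mpoly_of_dhomog (a *: f + b *: f'))@_m =
  a * (f : {mpoly K[3]})@_m + b * (f' : {mpoly K[3]})@_m.
Proof.
rewrite [X in X@_m]linearD mcoeffD /=.
by congr (_ + _); rewrite [X in X@_m]linearZ /= mcoeffZ.
Qed.

(** Multiplying [g (alpha f + beta f')] by the inverse of [k1], which is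
    finite, leaves [diag a * k2 (alpha f + beta f')], whose coefficients are
    weights times coefficients with a limit; those with a nonzero limit can be
    cancelled.  The factorization of [g] is kept in the conclusion because [g]
    is finite when [a] is. *)
Lemma pencil_destabilized F d (f f' : ternary_form K d) (g : T -> 'M[K]_3) :
  fractional_ideal G F -> (forall t, \det (g t) = 1) ->
  (forall i j, F (fun t =>
     coord (vbasis {: ternary_form K d}) i (form_act (g t) f) *
       coord (vbasis {: ternary_form K d}) j (form_act (g t) f') -
     coord (vbasis {: ternary_form K d}) j (form_act (g t) f) *
       coord (vbasis {: ternary_form K d}) i (form_act (g t) f'))) ->
  exists alpha beta kappa (a : T -> 'rV[K]_3),
    [/\ [/\ alpha != 0 \/ beta != 0, \det kappa = 1 & forall t, \prod_i a t 0 i = 1],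
        forall m : 'X_{1..3},
          (form_act kappa (alpha *: f + beta *: f') : {mpoly K[3]})@_m != 0 ->
          F (fun t => weight (a t) m) &
        exists k1 k2, [/\ finite_mx G k1, finite_mx G k2 &
          almost_all G [set t | g t = k1 t *m diag_mx (a t) *m k2 t]]].
Proof.
move=> hF g1 Fminor.
have [k1 [k2 [a [[fk1 k11] [fk2 k21] a1 ga]]]] := cartan_sl hG g1.
have [alpha [alpha0 [beta [beta0 [hal hbe ab Fab]]]]] := primitive_combination hF Fminor.
have [kappa kk] := (finite_mxP _ _).1 fk2.
exists alpha0, beta0, kappa, a; split; last by exists k1, k2.
  by split=> //; exact: lim_det1 kk k21.
pose u t := alpha t *: f + beta t *: f'.
have Fgu : coeffs_in F (fun t => form_act (g t) (u t)).
  apply: (coeffs_in_coord hG) => // i; apply: (fi_almost hF) (Fab i).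
  by apply: almost_all_sub (almost_all_setT hG) => // t _ /=; rewrite !linearD !linearZ.
have {}Fgu : coeffs_in F (fun t => form_act (\adj (k1 t)) (form_act (g t) (u t))).
  apply: (coeffs_in_act hG) => //; first exact: finite_adjmx.
  by move=> t; rewrite -invmx_sl // det_inv k11 invr1.
have Fau m : F (fun t => weight (a t) m * (form_act (k2 t) (u t) : {mpoly K[3]})@_m).
  apply: (fi_almost hF) (Fgu m); apply: almost_all_sub ga => // t; rewrite /mkset => ->.
  have ai := sl_diag_neq0 (a1 t).
  have ua : diag_mx (a t) \in unitmx by rewrite unitmx_sl // det_diag.
  rewrite -mulmxA !form_actM ?unitmx_mul ?ua ?unitmx_sl //.
  rewrite -form_actM ?unitmx_sl //; last by rewrite -invmx_sl // det_inv k11 invr1.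
  by rewrite -invmx_sl // mulVmx ?unitmx_sl // form_act1 form_act_diag.
have uv : lim_form G u (alpha0 *: f + beta0 *: f').
  move=> m; under eq_fun do rewrite form_coeff_comb; rewrite form_coeff_comb.
  by apply: limD => //; apply: limM => //; exact: lim_cst.
move=> m c0; apply: (fi_cancel hG hF (Fau m) _ c0).
exact: (lim_form_act hG uv kk k21).
Qed.

End Pencils.

(** * Degenerations of a form along a torus *)

Section Degeneration.
Context {T : pointedType} {K : closedFieldType}.
Variable G : set ((T -> K) * K)%type.
Context (hG : maximal_place G).

(** [f0] is the limit of [diag a * kappa f]: it keeps the monomials of
    [kappa f] with a weight of nonzero limit and loses the others. *)
Lemma degeneration d (f : ternary_form K d) kappa (a : T -> 'rV[K]_3) :
  \det kappa = 1 -> (forall t, \prod_i a t 0 i = 1) ->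
  (forall m : 'X_{1..3}, (form_act kappa f : {mpoly K[3]})@_m != 0 ->
     finite_at G (fun t => weight (a t) m)) ->
  exists2 f0, zariski_closure (SL3_orbit (@form_act K d) f) f0 &
    forall m : 'X_{1..3}, (f0 : {mpoly K[3]})@_m != 0 ->
      (form_act kappa f : {mpoly K[3]})@_m != 0 /\
      exists2 c, lim G (fun t => weight (a t) m) c & c != 0.
Proof.
move=> kappa1 a1 wfin; pose u t := form_act (diag_mx (a t)) (form_act kappa f).
have ai t := sl_diag_neq0 (a1 t).
have uE t m : (u t : {mpoly K[3]})@_m = weight (a t) m * (form_act kappa f : {mpoly K[3]})@_m.
  exact: form_act_diag.
have [f0 uf0] : exists f0, lim_form G u f0.
  apply: (finite_formP hG) => m; under eq_fun do rewrite uE.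
  have [->|fm] := eqVneq ((form_act kappa f : {mpoly K[3]})@_m) 0.
    by under eq_fun do rewrite mulr0; exists 0; exact: lim_cst.
  by apply: finiteM => //; [exact: wfin|eexists; exact: lim_cst].
exists f0.
  apply: (lim_vec_closure hG (lim_form_vec hG uf0)) => t.
  have d1 : \det (diag_mx (a t)) = 1 by rewrite det_diag.
  exists (diag_mx (a t) *m kappa); first by rewrite /SL3 /= det_mulmx d1 kappa1 mulr1.
  by rewrite form_actM ?unitmx_sl.
move=> m f0m; have [fm|fm] := eqVneq ((form_act kappa f : {mpoly K[3]})@_m) 0.
  case/eqP: f0m; apply: (lim_unique hG (uf0 m)).
  by under eq_fun do rewrite uE fm mulr0; exact: lim_cst.
split=> //; have [c wc] := wfin m fm; exists c => //; apply: contraNneq f0m => c0.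
rewrite -(mul0r ((form_act kappa f : {mpoly K[3]})@_m)) -c0.
apply/eqP/(lim_unique hG (uf0 m)); under eq_fun do rewrite uE.
by apply: limM => //; exact: lim_cst.
Qed.

Definition unit_at (x : T -> K) : Prop :=
  finite_at G x /\ finite_at G (fun t => (x t)^-1).

Lemma lim_unit x c : lim G x c -> c != 0 -> unit_at x.
Proof. by move=> xc c0; split; [exists c|exists c^-1; exact: limV]. Qed.

Lemma unit_atM x y : unit_at x -> unit_at y -> unit_at (fun t => x t * y t).
Proof.
move=> [fx fx'] [fy fy']; split; first exact: finiteM.
by under eq_fun do rewrite invfM; exact: finiteM.
Qed.

Lemma unit_atV x : unit_at x -> unit_at (fun t => (x t)^-1).
Proof. by move=> [fx fx']; split=> //; under eq_fun do rewrite invrK. Qed.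

Lemma unit_atXz x (z : int) : unit_at x -> unit_at (fun t => x t ^ z).
Proof.
move=> ux; have uX (n : nat) : unit_at (fun t => x t ^+ n).
  elim: n => [|n IH].
    under eq_fun do rewrite expr0.
    by apply: (lim_unit (lim_cst hG 1)); exact: oner_neq0.
  by under eq_fun do rewrite exprS; exact: unit_atM.
by case: z => n; [exact: uX|apply: unit_atV; exact: uX].
Qed.

(** The value group has no torsion. *)
Lemma unit_at_root x (z : int) : (forall t, x t != 0) -> z != 0 ->
  unit_at (fun t => x t ^ z) -> unit_at x.
Proof.
have root y n : (forall t, y t != 0) -> finite_at G (fun t => y t ^+ n.+1) -> finite_at G y.
  move=> y0 fy; case: (finite_or_inv0 hG y) => // yV.
  have /eqP : 1 = 0 :> K; last by rewrite oner_eq0.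
  apply: (lim_unique hG (lim_cst hG 1)).
  have := limX hG n.+1 yV; rewrite expr0n /= => /(lim0M hG)/(_ fy).
  by apply: eq_lim => t; rewrite -exprMn mulVf // expr1n.
have rootV y n : (forall t, y t != 0) -> unit_at (fun t => y t ^+ n.+1) -> unit_at y.
  move=> y0 [fy fy']; split; first exact: root fy.
  apply: (root _ n) => [t|]; first by rewrite invr_neq0.
  by under eq_fun do rewrite exprVn.
move=> x0; case: z => [[//|n]|n] _; first exact: rootV.
by move=> /unit_atV ux; apply: (rootV x n) => //; under eq_fun do rewrite -[_ ^+ _]invrK.
Qed.

Lemma sum_ord3 (V : zmodType) (F : 'I_3 -> V) : \sum_i F i = F 0 + F 1 + F 2.
Proof.
rewrite !big_ord_recl big_ord0 addr0 addrA.
by congr (_ + _ + _); congr F; exact: val_inj.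
Qed.

Lemma prod_ord3 (R : comNzRingType) (F : 'I_3 -> R) : \prod_i F i = F 0 * F 1 * F 2.
Proof.
rewrite !big_ord_recl big_ord0 mulr1 mulrA.
by congr (_ * _ * _); congr F; exact: val_inj.
Qed.

Lemma ord3_cases (P : 'I_3 -> Prop) : P 0 -> P 1 -> P 2 -> forall i, P i.
Proof.
move=> P0 P1 P2 [[|[|[|//]]] i3]; [move: P0|move: P1|move: P2];
  by congr P; exact: val_inj.
Qed.

(** The cross product of [m] with [(1, 1, 1)], with indices modulo [3]. *)
Definition cross1 (m : 'X_{1..3}) (i : 'I_3) : int := (m (i + 1))%:Z - (m (i + 2))%:Z.

Lemma cross1E (m : 'X_{1..3}) : [/\ cross1 m 0 = (m 1)%:Z - (m 2)%:Z,
  cross1 m 1 = (m 2)%:Z - (m 0)%:Z & cross1 m 2 = (m 0)%:Z - (m 1)%:Z].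
Proof.
by split; rewrite /cross1; congr (_ - _); congr (Posz (m _)); exact: val_inj.
Qed.

(** The valuations [v i] of the [a i] satisfy [sum v = 0], [m . v = 0] and
    [n . v = 0].  If [m], [n] and [(1, 1, 1)] were independent, Cramer's rule
    and the absence of torsion would give [v = 0]. *)
Lemma weights_dependent (a : T -> 'rV[K]_3) (m n : 'X_{1..3}) :
  (forall t, \prod_i a t 0 i = 1) ->
  unit_at (fun t => weight (a t) m) -> unit_at (fun t => weight (a t) n) ->
  (exists i, ~ finite_at G (fun t => a t 0 i)) ->
  \sum_i cross1 n i * (m i)%:Z = 0.
Proof.
move=> a1 um un [i0 ni0].
have ai t := sl_diag_neq0 (a1 t).
have a2 t : a t 0 2 = (a t 0 0 * a t 0 1)^-1.
  have := a1 t; rewrite prod_ord3 => a1t.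
  by apply: (mulfI (mulf_neq0 (ai t 0) (ai t 1))); rewrite a1t mulfV ?mulf_neq0.
have wE (k : 'X_{1..3}) t :
    weight (a t) k = a t 0 0 ^ ((k 2)%:Z - (k 0)%:Z) * a t 0 1 ^ ((k 2)%:Z - (k 1)%:Z).
  rewrite /weight prod_ord3 a2 invrK !exprVn exprMn !expfzDr //.
  by rewrite !exprnN -!exprnP; ring.
(* The determinant of [m], [n], [(1, 1, 1)], in the form in which it occurs
   when [a 2] is eliminated. *)
pose D := ((m 2)%:Z - (m 0)%:Z) * ((n 2)%:Z - (n 1)%:Z) -
   ((m 2)%:Z - (m 1)%:Z) * ((n 2)%:Z - (n 0)%:Z).
have DE : \sum_i cross1 n i * (m i)%:Z = D.
  by rewrite sum_ord3; have [-> -> ->] := cross1E n; rewrite /D; ring.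
rewrite DE; apply/eqP; apply: contraPT ni0 => D0; apply.
have u0 : unit_at (fun t => a t 0 0).
  apply: (unit_at_root (z := D)) => //.
  have := unit_atM (unit_atXz ((n 2)%:Z - (n 1)%:Z) um) (unit_atXz (- ((m 2)%:Z - (m 1)%:Z)) un).
  congr unit_at; apply/funext => t; rewrite !wE !expfzMl !exprz_exp.
  rewrite mulrACA -!expfzDr //.
  by rewrite [X in _ * _ ^ X](_ : _ = 0) ?expr0z ?mulr1; [congr (_ ^ _); rewrite /D|]; ring.
have u1 : unit_at (fun t => a t 0 1).
  apply: (unit_at_root (z := D)) => //.
  have := unit_atM (unit_atXz ((m 2)%:Z - (m 0)%:Z) un) (unit_atXz (- ((n 2)%:Z - (n 0)%:Z)) um).
  congr unit_at; apply/funext => t; rewrite !wE !expfzMl !exprz_exp.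
  rewrite mulrACA -!expfzDr //.
  by rewrite [X in _ ^ X * _](_ : _ = 0) ?expr0z ?mul1r; [congr (_ ^ _); rewrite /D|]; ring.
have u2 : unit_at (fun t => a t 0 2).
  by under eq_fun do rewrite a2; exact/unit_atV/unit_atM.
by move: i0; apply: ord3_cases; [exact: u0.1|exact: u1.1|exact: u2.1].
Qed.

(** A one-parameter subgroup of SL(3) that fixes all monomials in [S].  It is
    the cross product of [(1, 1, 1)] with an element of [S] that is not
    proportional to [(1, 1, 1)], if there is one. *)
Lemma fixing_weights (a : T -> 'rV[K]_3) (S : set 'X_{1..3}) :
  (forall t, \prod_i a t 0 i = 1) ->
  (forall m, S m -> unit_at (fun t => weight (a t) m)) ->
  (exists i, ~ finite_at G (fun t => a t 0 i)) ->
  exists lambda : 'I_3 -> int, [/\ exists i, lambda i != 0, \sum_i lambda i = 0 &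
    forall m, S m -> \sum_i lambda i * (m i)%:Z = 0].
Proof.
move=> a1 uS nfin.
have sum0 m : \sum_i cross1 m i = 0.
  by rewrite sum_ord3; have [-> -> ->] := cross1E m; ring.
have [[n [Sn /existsNP[i ni]]]|cS] := pselect (exists n, S n /\ ~ forall i, cross1 n i = 0).
  exists (cross1 n); split=> //; first by exists i; apply/eqP.
  by move=> m Sm; apply: weights_dependent nfin => //; exact: uS.
(* All elements of [S] are multiples of [(1, 1, 1)]: any subgroup will do. *)
exists (cross1 U_(0%R)%MM); split=> //.
  by exists 1; have [_ -> _] := cross1E U_(0%R)%MM; rewrite !mnmE.
move=> m Sm.
have cm i : cross1 m i = 0.
  by apply: contrapT => mi; apply: cS; exists m; split=> // h; apply: mi.
have [c0 c1 c2] := cross1E m.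
rewrite sum_ord3; have [-> -> ->] := cross1E U_(0%R)%MM; rewrite !mnmE /=.
have := cm 1; rewrite c1 => /eqP; rewrite subr_eq0 => /eqP m20.
have := cm 2; rewrite c2 => /eqP; rewrite subr_eq0 => /eqP m01.
by rewrite m20 m01; ring.
Qed.

End Degeneration.

(** * Stabilizers *)

Lemma infinite_range (T : Type) (s : nat -> T) : injective s -> ~ finite_set (range s).
Proof.
move=> sI fs; apply: infinite_nat.
pose g y : nat := xget 0%N [set n | s n = y].
apply: sub_finite_set (finite_image g fs) => n _.
exists (s n); first by exists n.
by apply: sI; apply: (xgetPex 0%N (P := [set k | s k = s n])); exists n.
Qed.

Lemma infinite_mx_entry (K : choiceType) m n (S : set 'M[K]_(m, n)) :
  ~ finite_set S -> exists i j, ~ finite_set [set g i j | g in S].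
Proof.
move=> nfS; apply: contrapT => nex; apply: nfS.
have fin i j : finite_set [set g i j | g in S].
  by apply: contrapT => nf; apply: nex; exists i, j.
pose s : seq K := flatten [seq sval (cid ((finite_seqP _).1 (fin ij.1 ij.2))) | ij : 'I_m * 'I_n].
have gs (g : 'M[K]_(m, n)) i j : S g -> g i j \in s.
  move=> Sg; apply/flattenP.
  exists (sval (cid ((finite_seqP _).1 (fin i j)))).
    by apply/mapP; exists (i, j); rewrite ?mem_enum.
  by case: cid => r /= rE; have : [set g i j | g in S] (g i j) by [exists g]; rewrite rE.
pose emb (g : 'M[seq_sub s]_(m, n)) : 'M[K]_(m, n) := map_mx val g.
apply: sub_finite_set (finite_image emb (finite_finset (X := setT))) => g Sg.
exists (\matrix_(i, j) SeqSub (gs g i j Sg)) => //.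
by apply/matrixP => i j; rewrite !mxE.
Qed.

Section Stabilizers.
Context {K : numClosedFieldType} {d : nat}.
Implicit Types f : ternary_form K d.

(** The subgroup contains [diag (t ^ lambda)] for the infinitely many
    [t = 2 ^ k]. *)
Lemma infinite_torus_stabilizer f (lambda : 'I_3 -> int) :
  (exists i, lambda i != 0) -> \sum_i lambda i = 0 ->
  (forall m : 'X_{1..3}, (f : {mpoly K[3]})@_m != 0 -> \sum_i lambda i * (m i)%:Z = 0) ->
  ~ finite_set (SL3_stabilizer (@form_act K d) f).
Proof.
move=> [i li] l0 lf fin.
pose s (k : nat) : 'rV[K]_3 := \row_i (2 ^+ k) ^ lambda i.
have t0 (k : nat) : 2 ^+ k != 0 :> K by rewrite expf_neq0 // pnatr_eq0.
have prodz k (e : 'I_3 -> int) : \prod_i (2 ^+ k : K) ^ e i = (2 ^+ k) ^ (\sum_i e i).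
  by rewrite prod_ord3 sum_ord3 !expfzDr.
have s0 k j : s k 0 j != 0 by rewrite mxE expfz_neq0.
apply: (@infinite_range _ (fun k => diag_mx (s k))).
  move=> k l /matrixP/(_ i i); rewrite !mxE eqxx !mulr1n => skl.
  have {skl} : (2 ^+ k : K) ^+ `|lambda i| = (2 ^+ l) ^+ `|lambda i|.
    case: (lambda i) skl => n //=; by move/(congr1 GRing.inv); rewrite !invrK.
  have two1 : 2 != 1 :> K by rewrite pnatr_eq1.
  rewrite -!exprM => /(ieexprIn (ltr0Sn _ 1) two1)/eqP.
  by rewrite eqn_pmul2r ?absz_gt0 // => /eqP.
apply: sub_finite_set fin => _ [k _ <-]; split.
  rewrite /SL3 /= det_diag; under eq_bigr do rewrite mxE.
  by rewrite prodz l0 expr0z.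
apply: form_eqP => m _; rewrite form_act_diag //.
have [->|fm] := eqVneq ((f : {mpoly K[3]})@_m) 0; first by rewrite mulr0.
rewrite (_ : weight _ _ = 1) ?mul1r // /weight.
have wz j : (s k 0 j)^-1 ^+ m j = (2 ^+ k) ^ (- (lambda j * (m j)%:Z)).
  by rewrite mxE invr_expz [LHS]exprnP exprz_exp mulNr.
by under eq_bigr do rewrite wz; rewrite prodz sumrN lf // oppr0 expr0z.
Qed.

Lemma finite_stabilizer_act f (g : 'M[K]_3) : \det g = 1 ->
  finite_set (SL3_stabilizer (@form_act K d) f) ->
  finite_set (SL3_stabilizer (@form_act K d) (form_act g f)).
Proof.
move=> g1 fin; have ug := unitmx_sl g1.
apply: sub_finite_set (finite_image (fun h => g *m h *m invmx g) fin) => h [h1 hf].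
have uh := unitmx_sl h1.
exists (invmx g *m h *m g); last by rewrite !mulmxA mulmxV // mul1mx mulmxK.
split; first by rewrite /SL3 /= !det_mulmx det_inv g1 invr1 mul1r mulr1.
rewrite -mulmxA form_actM ?unitmx_inv ?unitmx_mul ?uh // form_actM // hf.
by rewrite -form_actM ?unitmx_inv // mulVmx // form_act1.
Qed.

Context {T : pointedType}.
Variable G : set ((T -> K) * K)%type.
Context (hG : maximal_place G).

Lemma unstable_of_weights f kappa (a : T -> 'rV[K]_3) :
  \det kappa = 1 -> (forall t, \prod_i a t 0 i = 1) ->
  (forall m : 'X_{1..3}, (form_act kappa f : {mpoly K[3]})@_m != 0 ->
     lim G (fun t => weight (a t) m) 0) ->
  ~ semistable_curve f.
Proof.
move=> kappa1 a1 w0 sf; apply: sf.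
have [m fm|f0 f0cl f0w] := degeneration hG kappa1 a1 (f := f).
  by exists 0; exact: w0.
suff <- : f0 = 0 by [].
apply: form_eqP => m _; rewrite mcoeff0; apply: contrapT => /eqP /f0w[fm [c wc /eqP]].
by apply; exact: (lim_unique hG wc (w0 m fm)).
Qed.

Lemma not_stable_of_weights f kappa (a : T -> 'rV[K]_3) :
  \det kappa = 1 -> (forall t, \prod_i a t 0 i = 1) ->
  (forall m : 'X_{1..3}, (form_act kappa f : {mpoly K[3]})@_m != 0 ->
     finite_at G (fun t => weight (a t) m)) ->
  (exists i, ~ finite_at G (fun t => a t 0 i)) ->
  ~ stable_curve f.
Proof.
move=> kappa1 a1 wfin ainf [closed_orbit fin].
have [f0 f0cl f0w] := degeneration hG kappa1 a1 wfin.
have [g g1 gf] : SL3_orbit (@form_act K d) f f0.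
  by apply: (f0cl (SL3_orbit (@form_act K d) f)); split.
pose S : set 'X_{1..3} := [set m | (f0 : {mpoly K[3]})@_m != 0].
have uS m : S m -> unit_at G (fun t => weight (a t) m).
  by move=> /f0w[_ [c wc c0]]; exact: (lim_unit hG wc c0).
have [lambda [l0 l1 lS]] := fixing_weights hG a1 uS ainf.
apply: (infinite_torus_stabilizer l0 l1 lS).
by rewrite -gf; exact: finite_stabilizer_act.
Qed.

End Stabilizers.

(** * From orbit closures to places *)

Lemma zariski_closedP {K : fieldType} {W : vectType K} (A : set W) :
  zariski_closure A `<=` A -> zariski_closed A.
Proof.
move=> clA; exists [set p | forall y, A y -> poly_fun p y = 0].
apply/seteqP; split=> [x Ax p|x hx]; first by apply.
apply: clA => Z [[S ->] AS] p Sp; apply: hx => y Ay; exact: AS.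
Qed.

(** A set of matrices as a family over a pointed type: matrices outside of the
    set are sent to [g0]. *)
Lemma sl_family {K : closedFieldType} n (S : set 'M[K]_n) (g0 : 'M[K]_n) : S g0 ->
  exists (T : pointedType) (g : T -> 'M[K]_n), (forall t, S (g t)) /\
    forall h, S h -> exists t, g t = h.
Proof.
move=> Sg0; pose T : pointedType := HB.pack 'M[K]_n (isPointed.Build 'M[K]_n g0).
exists T, (fun t : 'M[K]_n => if `[< S t >] then t else g0); split.
  by move=> t; case: asboolP.
by move=> h Sh; exists h; rewrite asboolT.
Qed.

Lemma closure_place {K : closedFieldType} {W : vectType K} (act : 'M[K]_3 -> W -> W) x z :
  zariski_closure (SL3_orbit act x) z ->
  exists (T : pointedType) G (g : T -> 'M[K]_3), [/\ maximal_place G,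
    forall t, \det (g t) = 1 & lim_vec G (fun t => act (g t) x) z].
Proof.
move=> xz; have S1 : SL3 (1%:M : 'M[K]_3) by rewrite /SL3 /= det1.
have [T [g [g1 gS]]] := sl_family S1.
have [p pT|G hG Gz] := @adherent_place T K _
    (fun t i => coord (vbasis {: W}) i (act (g t) x)) (fun i => coord (vbasis {: W}) i z).
  apply: (xz [set y | forall q, [set p] q -> poly_fun q y = 0]); last by [].
  split; first by exists [set p].
  by move=> _ [h /gS[t <-] <-] q ->; exact: pT.
by exists T, G, g.
Qed.

Lemma finite_roots {K : closedFieldType} (q : {poly K}) : q != 0 ->
  finite_set [set c | root q c].
Proof.
move=> q0; have [r qr] := closed_field_poly_normal q.
apply: sub_finite_set (finite_seq r) => c /=.
by rewrite qr rootZ ?lead_coef_eq0 // root_prod_XsubC.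
Qed.

(** An affine curve is not complete: a function with infinitely many values has
    a pole at some place. *)
Lemma unbounded_place {K : closedFieldType} {T : pointedType} (x : T -> K) :
  ~ finite_set (range x) ->
  exists2 G, maximal_place G & lim G (fun t => (x t)^-1) 0.
Proof.
move=> xinf.
pose G0 : set ((T -> K) * K)%type :=
  [set u | exists q : {poly K}, u = (fun t => q.[(x t)^-1], q.[0])].
have h0 : partial_place G0.
  constructor.
  - by move=> c; exists c%:P; congr pair; [apply/funext => t|]; rewrite hornerC.
  - move=> _ _ [p ->] [q ->]; exists (p - q).
    by congr pair => /=; [apply/funext => t|]; rewrite hornerD hornerN.
  - move=> _ _ [p ->] [q ->]; exists (p * q).
    by congr pair => /=; [apply/funext => t|]; rewrite hornerM.
  - move=> c [q [q0 ->]]; have [->|/finite_roots fq] := eqVneq q 0; first by rewrite horner0.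
    case: xinf; apply: sub_finite_set (finite_image GRing.inv fq) => _ [t _ <-].
    exists (x t)^-1; last by rewrite invrK.
    by apply/rootP; rewrite -[LHS]/((fun t => q.[(x t)^-1]) t) -q0.
have [G [hG G0G]] := exists_maximal_place h0.
exists G => //; apply: G0G; exists 'X.
by congr pair => /=; [apply/funext => t|]; rewrite hornerX.
Qed.

Section WedgeLimits.
Context {T : pointedType} {K : closedFieldType}.
Variable G : set ((T -> K) * K)%type.
Context (hG : maximal_place G).

Lemma lim_ffun (V : vectType K) (w : T -> ext2 V) z : lim_vec G w z ->
  forall p, lim G (fun t => w t p) (z p).
Proof.
move=> wz p.
have wE (v : ext2 V) : v p = \sum_i coord (vbasis {: ext2 V}) i v * (vbasis {: ext2 V})`_i p.
  rewrite {1}(coord_vbasis (memvf v)) sum_ffunE.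
  by apply: eq_bigr => i _; rewrite ffunE.
under eq_fun do rewrite wE; rewrite wE.
by apply: lim_sum => // i _; apply: limM => //; exact: lim_cst.
Qed.

Lemma wedge_minors F (V : vectType K) (x y : T -> V) : fractional_ideal G F ->
  (forall p, F (fun t => wedge (x t) (y t) p)) ->
  forall i j, F (fun t => coord (vbasis {: V}) i (x t) * coord (vbasis {: V}) j (y t)
                        - coord (vbasis {: V}) j (x t) * coord (vbasis {: V}) i (y t)).
Proof.
move=> hF Fw.
have lt (i j : 'I_(\dim {: V})) : (i < j)%N -> F (fun t =>
    coord (vbasis {: V}) i (x t) * coord (vbasis {: V}) j (y t)
  - coord (vbasis {: V}) j (x t) * coord (vbasis {: V}) i (y t)).
  move=> ij; pose p : ext2_index V := exist _ (i, j) ij.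
  by have := Fw p; congr F; apply/funext => t; rewrite ffunE.
move=> i j; have [ij|ji|/val_inj ->] := ltngtP i j.
- exact: lt.
- have := fiM hF (lt _ _ ji) (ex_intro _ _ (lim_cst hG (-1))).
  by congr F; apply/funext => t; ring.
- by under eq_fun do rewrite subrr; exact: (fi0 hF).
Qed.

End WedgeLimits.

(** * Stability of pencils *)

Section SemistablePencils.
Context {K : numClosedFieldType} {d : nat}.
Implicit Types f : ternary_form K d.

Lemma ext2_act_wedge (g : 'M[K]_3) f f' :
  ext2_act g (wedge f f') = wedge (form_act g f) (form_act g f').
Proof. exact: ext2_map_wedge. Qed.

Lemma basis_comb (P : {vspace ternary_form K d}) f f' (alpha beta : K) :
  basis_of P [:: f; f'] -> alpha != 0 \/ beta != 0 ->
  alpha *: f + beta *: f' \in P /\ alpha *: f + beta *: f' != 0.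
Proof.
move=> /andP[/eqP <- fr] ab; split.
  by apply: memvD; apply: memvZ; apply: memv_span; rewrite !inE eqxx ?orbT.
apply/eqP => comb0.
have /freeP/(_ (fun i : 'I_2 => [:: alpha; beta]`_i)) := fr.
rewrite big_ord_recl big_ord1 /= => /(_ comb0) h.
have a0 : alpha = 0 := h ord0; have b0 : beta = 0 := h (lift ord0 ord0).
by case: ab => /eqP.
Qed.

Lemma semistable_pencil_of_members (P : {vspace ternary_form K d}) :
  (forall f, f \in P -> f != 0 -> semistable_curve f) -> semistable_pencil P.
Proof.
move=> ssP f f' bP /closure_place[T [G [g [hG g1 g0]]]].
have Fw p : lim G (fun t => wedge (form_act (g t) f) (form_act (g t) f') p) 0.
  have := lim_ffun hG g0 p; rewrite ffunE.
  by under eq_fun do rewrite ext2_act_wedge.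
have hF := fractional_ideal_lim0 hG.
have [alpha [beta [kappa [a [[ab k1 a1] wF _]]]]] :=
  pencil_destabilized hG hF g1 (wedge_minors hG hF Fw).
have [cP c0] := basis_comb bP ab.
exact: (unstable_of_weights hG k1 a1 wF (ssP _ cP c0)).
Qed.

Section StableMembers.
Context (P : {vspace ternary_form K d}) (f f' : ternary_form K d).
Context (bP : basis_of P [:: f; f']).
Context (stP : forall f, f \in P -> f != 0 -> stable_curve f).

(** Properness of the orbit map of [f /\ f'], in the form of the valuative
    criterion. *)
Lemma finite_of_finite_wedge (T : pointedType) G (g : T -> 'M[K]_3) :
  maximal_place G -> (forall t, \det (g t) = 1) ->
  (forall p, finite_at G (fun t => ext2_act (g t) (wedge f f') p)) ->
  finite_mx G g.
Proof.
move=> hG g1 Fw; have hF := fractional_ideal_finite hG.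
have {}Fw p : finite_at G (fun t => wedge (form_act (g t) f) (form_act (g t) f') p).
  by have := Fw p; under eq_fun do rewrite ext2_act_wedge.
have [alpha [beta [kappa [a [[ab k1 a1] wF [k [l [fk fl gkl]]]]]]]] :=
  pencil_destabilized hG hF g1 (wedge_minors hG hF Fw).
have [cP c0] := basis_comb bP ab.
have fa i : finite_at G (fun t => a t 0 i).
  apply: contrapT => nfa.
  by apply: (not_stable_of_weights hG k1 a1 wF _ (stP cP c0)); exists i.
have fd : finite_mx G (fun t => diag_mx (a t)).
  move=> i j; under eq_fun do rewrite mxE.
  have [->|_] := eqVneq i j; first by under eq_fun do rewrite mulr1n.
  by under eq_fun do rewrite mulr0n; exists 0; exact: lim_cst.
have fkal := finite_mulmx hG (finite_mulmx hG fk fd) fl.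
move=> i j; apply: (finite_almost hG) (fkal i j).
by apply: almost_all_sub gkl => // t /= ->.
Qed.

Lemma closed_orbit : zariski_closed (SL3_orbit (@ext2_act K d) (wedge f f')).
Proof.
apply: zariski_closedP => z /closure_place[T [G [g [hG g1 gz]]]].
have wz := lim_ffun hG gz.
have /(finite_mxP _ _)[gamma ggamma] : finite_mx G g.
  by apply: finite_of_finite_wedge => // p; exists (z p); exact: wz.
exists gamma; first exact: (lim_det1 hG ggamma g1).
rewrite ext2_act_wedge; apply/ffunP => p; apply: (lim_unique hG _ (wz p)).
under eq_fun do rewrite ext2_act_wedge ffunE; rewrite ffunE.
have gcoord (v : ternary_form K d) : lim_vec G (fun t => form_act (g t) v) (form_act gamma v).
  apply: (lim_form_vec hG); apply: (lim_form_act hG) => // m; exact: lim_cst.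
by apply: (limB hG); apply: (limM hG); exact: gcoord.
Qed.

Lemma finite_stabilizer : finite_set (SL3_stabilizer (@ext2_act K d) (wedge f f')).
Proof.
apply: contrapT => /infinite_mx_entry[i [j ninf]].
(* The elements with [g i j = 0] are discarded: on the others, [g i j] times
   its inverse is [1], which cannot tend to [0]. *)
pose S : set 'M[K]_3 :=
  [set g | SL3_stabilizer (@ext2_act K d) (wedge f f') g /\ g i j != 0].
have nS : ~ finite_set [set g i j | g in S].
  move=> fS; apply: ninf; apply: (@sub_finite_set _ _ ([set g i j | g in S] `|` [set 0])).
    move=> _ [g gs <-]; have [->|gij] := eqVneq (g i j) 0; first by right.
    by left; exists g.
  by rewrite finite_setU; split.
have [g0 Sg0] : exists g, S g.
  apply: contrapT => nex; apply: nS; rewrite (_ : [set _ | _ in S] = set0) //.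
  by apply/seteqP; split=> // x [g Sg _]; case: nex; exists g.
have [T [g [gS Sg]]] := sl_family Sg0.
have [|G hG lim0] := @unbounded_place K T (fun t => g t i j).
  move=> fr; apply: nS; apply: sub_finite_set fr => _ [h /Sg[t <-] <-].
  by exists t.
have fg : finite_mx G g.
  apply: finite_of_finite_wedge => // [t|p]; first by have [[]] := gS t.
  exists (wedge f f' p); apply: eq_lim (lim_cst hG _) => t.
  by have [[_ ->]] := gS t.
have /eqP : 1 = 0 :> K; last by rewrite oner_eq0.
apply: (lim_unique hG (lim_cst hG 1)).
apply: eq_lim (lim0M hG lim0 (fg i j)) => t.
by rewrite mulVf //; have [] := gS t.
Qed.

End StableMembers.

End SemistablePencils.

Theorem theorem1p4 (R : realType) (d : nat) (hd : (0 < d)%N)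
    (P : {vspace ternary_form R[i] d}) (hP : \dim P = 2%N) :
  ((forall f : ternary_form R[i] d, f \in P -> f != 0 -> semistable_curve f) ->
     semistable_pencil P) /\
  ((forall f : ternary_form R[i] d, f \in P -> f != 0 -> stable_curve f) ->
     stable_pencil P).
Proof.
split=> [ssP|stP]; first exact: semistable_pencil_of_members.
by move=> f f' bP; split; [exact: closed_orbit bP stP|exact: finite_stabilizer bP stP].
Qed.
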